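(* Let $-\infty<a<b<\infty$, $n\ge1$, and let $V\in L^\infty([a,b],\mathbb{R}^{n\times n})$ with $V=V^\top$ a.e. Then for all $r\in\mathbb{R}$ and all real $r_1<r_2$ the following hold. (i) If $0\le\theta_1<\theta_2<2\pi$, then $$|N(r,\theta_2)-N(r,\theta_1)|\le 2n,\qquad |N([r_1,r_2),\theta_2)-N([r_1,r_2),\theta_1)|\le 4n.$$ (ii) If $0<\theta_1<\theta_2<\pi$ or $\pi<\theta_1<\theta_2<2\pi$, then $$|N(r,\theta_2)-N(r,\theta_1)|\le n,\qquad |N([r_1,r_2),\theta_2)-N([r_1,r_2),\theta_1)|\le 2n.$$
   Context: For $\theta\in[0,2\pi)$, $H_\theta u=-u''+Vu$ is the self-adjoint operator on $L^2([a,b],\mathbb{C}^n)$ with domain $\{u: u,u'\in AC([a,b],\mathbb{C}^n),\ u''\in L^2([a,b],\mathbb{C}^n),\ u(b)=e^{i\theta}u(a),\ u'(b)=e^{i\theta}u'(a)\}$; it is bounded from below with compact resolvent. The counting functions are $N(r,\theta)=\sum_{\lambda<r}\dim_{\mathbb{C}}\ker(H_\theta-\lambda)$ and $N([r_1,r_2),\theta)=\sum_{r_1\le\lambda<r_2}\dim_{\mathbb{C}}\ker(H_\theta-\lambda)$. *)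

(* Defs.v *)
From HB Require Import structures.
From mathcomp Require Import all_boot all_order all_algebra.
From mathcomp Require Export complex.
From mathcomp Require Import all_classical all_reals all_analysis.

Set Implicit Arguments.
Unset Strict Implicit.
Unset Printing Implicit Defensive.
Import Order.TTheory GRing.Theory Num.Theory numFieldNormedType.Exports.
Local Open Scope classical_set_scope.
Local Open Scope ring_scope.

(* Functions on [a, b] are represented by total functions on R; only their
   values on [a, b] are ever used. *)

Definition ae_on (R : realType) (a b : R) (P : R -> Prop) : Prop :=
  \forall x \ae (@lebesgue_measure R), x \in `[a, b] -> P x.

Definition Lp_on (R : realType) (a b : R) (p : \bar R) (f : R -> R) : Prop :=
  (f \_ `[a, b]) \in Lfun (@lebesgue_measure R) p.

Definition abs_continuous (R : realType) (a b : R) (f : R -> R) : Prop :=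
  forall e : R, 0 < e -> exists2 d : R, 0 < d &
    forall (m : nat) (s t : 'I_m -> R),
      (forall j, [/\ a <= s j, s j < t j & t j <= b]) ->
      trivIset setT (fun j => `]s j, t j[%classic) ->
      \sum_(j < m) (t j - s j) < d ->
      \sum_(j < m) `|f (t j) - f (s j)| < e.

(* A C^n-valued function is absolutely continuous, in L^p, or differentiable
   when the real and imaginary parts of all its components are. *)
Definition componentwise (R : realType) (n : nat) (P : (R -> R) -> Prop)
    (u : R -> 'cV[R[i]]_n) : Prop :=
  forall i : 'I_n,
    P (fun x => complex.Re (u x i ord0)) /\ P (fun x => complex.Im (u x i ord0)).

Definition is_derive_vec (R : realType) (n : nat)
    (u : R -> 'cV[R[i]]_n) (x : R) (d : 'cV[R[i]]_n) : Prop :=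
  forall i : 'I_n,
    is_derive x 1 (fun y => complex.Re (u y i ord0)) (complex.Re (d i ord0)) /\
    is_derive x 1 (fun y => complex.Im (u y i ord0)) (complex.Im (d i ord0)).

Definition expi (R : realType) (t : R) : R[i] := Complex (cos t) (sin t).

(* [u1] and [u2] are the first and second derivatives of [u]. As [u1] is
   absolutely continuous it is the continuous representative of u', which is
   the one the boundary condition refers to. *)
Definition dom_H (R : realType) (n : nat) (a b theta : R)
    (u u1 u2 : R -> 'cV[R[i]]_n) : Prop :=
  [/\ componentwise (abs_continuous a b) u,
      componentwise (abs_continuous a b) u1,
      ae_on a b (fun x => is_derive_vec u x (u1 x)) &
      ae_on a b (fun x => is_derive_vec u1 x (u2 x))] /\
  [/\ componentwise (Lp_on a b 2%:E) u2,
      u b = expi theta *: u a &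
      u1 b = expi theta *: u1 a].

(* The graph of H_theta: [u] is in the domain and H_theta u = f, where the
   elements of L^2([a, b], C^n) are given by representatives. *)
Definition H_graph (R : realType) (n : nat) (a b : R) (V : R -> 'M[R]_n)
    (theta : R) (u f : R -> 'cV[R[i]]_n) : Prop :=
  exists u1 u2 : R -> 'cV[R[i]]_n,
    dom_H a b theta u u1 u2 /\
    ae_on a b (fun x => f x = - u2 x + map_mx (real_complex R) (V x) *m u x).

Definition ker_H_sub (R : realType) (n : nat) (a b : R) (V : R -> 'M[R]_n)
    (theta lambda : R) : set (R -> 'cV[R[i]]_n) :=
  [set u | H_graph a b V theta u (fun x => real_complex R lambda *: u x)].

Definition lin_indep_on (R : realType) (n : nat) (a b : R) (k : nat)
    (u : 'I_k -> R -> 'cV[R[i]]_n) : Prop :=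
  forall c : 'I_k -> R[i],
    ae_on a b (fun x => \sum_(j < k) c j *: u j x = 0) -> forall j, c j = 0.

(* The complex dimension, possibly +oo, of the image in L^2([a, b], C^n) of a
   space [S] of functions. *)
Definition dimC (R : realType) (n : nat) (a b : R)
    (S : set (R -> 'cV[R[i]]_n)) : \bar R :=
  ereal_sup [set (k%:R : R)%:E | k in
    [set k : nat | exists u : 'I_k -> R -> 'cV[R[i]]_n,
      (forall j, S (u j)) /\ lin_indep_on a b u]].

(* The counting functions take values in [0, +oo] a priori. Note that in \bar R
   the value of `|+oo - +oo| is +oo, so that a finite bound on the absolute
   difference of two of them entails that both are finite. *)
Definition N_lt (R : realType) (n : nat) (a b : R) (V : R -> 'M[R]_n)
    (r theta : R) : \bar R :=
  \esum_(lambda in [set l : R | l < r]) dimC a b (ker_H_sub a b V theta lambda).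

Definition N_itv (R : realType) (n : nat) (a b : R) (V : R -> 'M[R]_n)
    (r1 r2 theta : R) : \bar R :=
  \esum_(lambda in [set l : R | r1 <= l < r2])
    dimC a b (ker_H_sub a b V theta lambda).

(* Main.v *)
Require Import Defs.
From HB Require Import structures.
From mathcomp Require Import all_boot all_order all_algebra.
From mathcomp Require Import all_classical all_reals all_analysis.
From mathcomp Require Import measurable_realfun ess_sup_inf.
From mathcomp Require Import sesquilinear spectral.
From mathcomp Require Import zify ring lra.

(** The counting function of H_theta below an energy r is the number of negative
    squares of a Hermitian form, the form of H_theta - r. For two boundary
    conditions these forms agree on the functions that vanish at [a], a subspace of
    codimension n of both form domains, so the numbers of negative squares differ by
    at most n (lemma [morse_index_codim]). This bound holds for all angles and
    implies the four inequalities, as N([r1, r2), theta) is the difference of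
    N(r2, theta) and N(r1, theta).

    The identity between the number of eigenvalues and the number of negative
    squares is proved without spectral theory in infinite dimension, by a reduction
    to matrices. Divide [a, b] into m equal cells, so short that for |l| <= Lam a
    solution of u'' = (V - l) u in a cell is determined by its boundary values and
    is nearly affine ([sol_exists], [sol_eq0], [sol_affine]). Functions which solve
    the equation in every cell are then parametrized by their values at the nodes,
    and the form becomes a Hermitian matrix A(l) of size m n, built from the
    Dirichlet-to-Neumann matrices of the cells. A vector of nodal values is in the
    kernel of A(l) when the derivatives match at the nodes, that is, when it comes
    from an eigenfunction: [dimC_nodal].

    By Lagrange's identity, for solutions u and v with the same nodal values at the
    energies l and l', the forms of A(l) and A(l') differ by the integral of
    (l' - l) u . v, which is positive for l < l' as both solutions are close to the
    same affine functions ([dtn_decreasing]). Therefore A is strictly decreasing and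
    continuous, it is nonnegative for low energies, and its index at r is the sum of
    the dimensions of the kernels met below r ([morse_index_lt],
    [morse_index_near], [esum_jumps], [N_lt_index]). In particular the counting
    functions are finite.

    As V is only measurable, second derivatives are defined almost everywhere. The
    analysis rests on two facts: an absolutely continuous function with nonnegative
    derivative is nondecreasing ([abs_continuous_nondecreasing]), and bounded
    measurable functions have Lipschitz primitives ([prim_exists]). *)

Set Implicit Arguments.
Unset Strict Implicit.
Unset Printing Implicit Defensive.
Import Order.TTheory GRing.Theory Num.Theory numFieldNormedType.Exports.
Local Open Scope classical_set_scope.
Local Open Scope sesquilinear_scope.
Local Open Scope ring_scope.

(** * Monotonicity of absolutely continuous functions *)

Section AbsolutelyContinuous.
Variable R : realType.
Implicit Types (s t x y z e d : R) (F f : R -> R).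
Local Notation mu := (@lebesgue_measure R).

Lemma derive_expansion F x d e : is_derive x 1 F d -> 0 < e ->
  exists2 r, 0 < r & forall h, `|h| < r -> `|F (x + h) - F x - h * d| <= e * `|h|.
Proof.
move=> [dF vF] e0.
have : h^-1 *: ((F \o shift x) (h *: 1) - F x) @[h --> 0^'] --> d.
  by rewrite -vF; exact: dF.
move=> /cvgrPdist_le /(_ e e0) /nbhs_ballP[r /= r0 H].
exists r => // h hr; have [->|h0] := eqVneq h 0.
  by rewrite addr0 subrr mul0r subr0 !normr0 mulr0.
have := H h; rewrite /ball /= sub0r normrN => /(_ hr h0).
rewrite /GRing.scale /= mulr1 [h + x]addrC => {}H.
have -> : F (x + h) - F x - h * d = - (h * (d - h^-1 * (F (x + h) - F x))).
  by rewrite mulrBr mulrA mulfV// mul1r opprB.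
by rewrite normrN normrM mulrC ler_wpM2r.
Qed.

(** The increment is taken across [x], not from [x]: the supremum argument below
    has to step over its supremum from a point on its left. *)
Lemma straddle F x d e : is_derive x 1 F d -> 0 <= d -> 0 < e ->
  exists2 r, 0 < r & forall y z, x - r < y -> y <= x -> x <= z -> z < x + r ->
    - e * (z - y) <= F z - F y.
Proof.
move=> /derive_expansion dF d0 e0; have [r r0 H] := dF _ e0.
exists r => // y z ry yx xz zr.
have := H (y - x); rewrite ler0_norm ?subr_le0// opprB => /(_ ltac:(lra)).
have := H (z - x); rewrite ger0_norm ?subr_ge0// => /(_ ltac:(lra)).
rewrite ![x + (_ - x)]addrC !subrK !ler_norml => /andP[Hz _] /andP[_ Hy].
have : 0 <= (z - x) * d by rewrite mulr_ge0// subr_ge0.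
have : 0 <= (x - y) * d by rewrite mulr_ge0// subr_ge0.
nra.
Qed.

(* the list is built from left to right, so its head is the rightmost interval *)
Let chain (l : seq (R * R)) := pairwise (fun p q : R * R => q.2 <= p.1) l.

Lemma total_length_le (G : set R) (l : seq (R * R)) e : open G -> chain l ->
  (forall p, p \in l -> p.1 < p.2 /\ `]p.1, p.2[ `<=` G) ->
  (mu G < e%:E)%E ->
  trivIset setT (fun j : 'I_(size l) => `](nth 0 l j).1, (nth 0 l j).2[%classic) /\
  \sum_(j < size l) ((nth 0 l j).2 - (nth 0 l j).1) < e.
Proof.
move=> oG cl lG Ge.
have ml (j : 'I_(size l)) : nth 0 l j \in l by exact: mem_nth.
have tI : trivIset setT
    (fun j : 'I_(size l) => `](nth 0 l j).1, (nth 0 l j).2[%classic).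
  apply/trivIsetP => i j _ _; wlog ij : i j / (i < j)%N.
    move=> W; rewrite neq_ltn => /orP[ij|ji]; first by apply: W; rewrite // neq_ltn ij.
    by rewrite setIC; apply: W; rewrite // neq_ltn ji.
  move=> _; apply/seteqP; split => // x [] /=; rewrite !in_itv/= => /andP[xi _] /andP[_ xj].
  have := (pairwiseP 0 cl) i j; rewrite !inE => /(_ (ltn_ord i) (ltn_ord j) ij) /=.
  by move=> ij'; move: (lt_trans xi (lt_le_trans xj ij')); rewrite ltxx.
split => //; rewrite -lte_fin; apply: le_lt_trans Ge.
rewrite -sumEFin.
rewrite (eq_bigr (fun j : 'I_(size l) => mu `](nth 0 l j).1, (nth 0 l j).2[)); last first.
  by move=> j _; rewrite lebesgue_measure_itv/= lte_fin (lG _ (ml j)).1.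
rewrite -(@measure_bigsetU_ord _ _ _ mu _ xpredT)//.
apply: le_measure; rewrite ?inE//=.
- by apply: bigsetU_measurable => i _; exact: measurable_itv.
- exact: open_measurable.
- apply: (big_ind (fun A => A `<=` G)) => [//|A B AG BG|j _]; last exact: (lG _ (ml j)).2.
  by move=> x []; [exact: AG|exact: BG].
Qed.

(** Nothing is known on a null set, but it lies in an open set of small measure,
    over which absolute continuity makes the variation small. Everywhere else the
    derivative prevents a decrease. The two kinds of points are dealt with in one
    sweep from [s] to [t], a supremum argument, which keeps a list of the disjoint
    intervals of the open set that were used on the way. *)
Lemma abs_continuous_nondecreasing s t F : s <= t -> abs_continuous s t F ->
  ae_on s t (fun x => exists2 d, 0 <= d & is_derive x 1 F d) -> F s <= F t.
Proof.
move=> st acF [N [mN N0 subN]].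
apply/ler_addgt0Pr => e e0.
pose e1 := e / (2 * (t - s + 1)).
have e10 : 0 < e1 by rewrite divr_gt0// mulr_gt0// ltr_wpDl// subr_ge0.
have e1e : e1 * (t - s) <= e / 2.
  have : e1 * (2 * (t - s + 1)) = e by rewrite divfK// mulf_neq0//; lra.
  by lra.
have [d d0 acd] := acF (e / 2) ltac:(by rewrite divr_gt0).
have Noo : (mu N < +oo)%E by rewrite N0.
have [G [oG NG Gd]] := lebesgue_regularity_outer mN Noo d0.
have Gd' : (mu G < d%:E)%E.
  apply: le_lt_trans Gd; rewrite -[leRHS]adde0 -[X in (_ <= _ + X)%E]N0.
  rewrite -{1}(setDUK NG) setUC.
  by apply: (le_trans (measureU2 _ _ _)) => //; apply: measurableD => //; exact: open_measurable.
pose good l x := [/\ chain l,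
  forall p, p \in l -> [/\ s <= p.1, p.1 < p.2, p.2 <= x & `]p.1, p.2[ `<=` G] &
  F s - e1 * (x - s) - \sum_(p <- l) `|F p.2 - F p.1| <= F x].
suff [l [cl lG Ft]] : exists l, good l t.
  have lG' p : p \in l -> p.1 < p.2 /\ `]p.1, p.2[ `<=` G by move=> /lG[].
  have [tI sl] := total_length_le oG cl lG' Gd'.
  have := acd _ (fun j => (nth 0 l j).1) (fun j => (nth 0 l j).2) _ tI sl.
  move=> H; rewrite (big_nth 0) big_mkord in Ft.
  have {}H := H (fun j => let: And4 a b c _ := lG _ (mem_nth 0 (ltn_ord j)) in And3 a b c).
  lra.
pose A := [set x | s <= x <= t /\ exists l, good l x].
have As : A s.
  split; first by rewrite lexx.
  by exists [::]; split => //; rewrite big_nil subrr mulr0 !subr0.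
have supA : has_sup A by split; [exists s|exists t => x [/andP[]]].
pose c := sup A.
have cs : s <= c by apply: ub_le_sup => //; exact: supA.2.
have ct : c <= t by apply: ge_sup; [exact: supA.1|move=> x [/andP[]]].
(* c lies either in the open set or at a point where the derivative is known *)
have [r r0 step] : exists2 r, 0 < r & forall y z, c - r < y -> y <= c -> c <= z ->
    z < c + r -> y < z -> s <= y -> (exists l, good l y) -> exists l, good l z.
  have [Nc|/(contra_not (@subN c))/notP ] := pselect (N c).
    have : G c by exact: NG.
    move: oG => /[apply] /nbhs_ballP[r /= r0 rG]; exists r => // y z ry yc cz zr yz sy.
    move=> [l [cl lG Fy]]; exists ((y, z) :: l); split => /=.
    - by apply/andP; split; [apply/allP => p /lG[]|exact: cl].
    - move=> p; rewrite inE => /predU1P[->|/lG[? ? ? ?]]; split => //=; last first.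
        by apply: le_trans (ltW yz).
      move=> x /=; rewrite in_itv/= => /andP[? ?]; apply: rG; rewrite /ball/= ltr_norml.
      by apply/andP; split; lra.
    - rewrite big_cons/=; have := ler_norm (- (F z - F y)); rewrite normrN.
      have : 0 <= e1 * (z - y) by rewrite mulr_ge0 ?subr_ge0// ltW.
      move: Fy; set S := \sum_(_ <- _) _ => Fy.
      by lra.
  rewrite /= in_itv/= cs ct => /(_ isT)[d' d'0 dF].
  have [r r0 H] := straddle dF d'0 e10; exists r => // y z ry yc cz zr yz sy [l [cl lG Fy]].
  exists l; split => //; first by move=> p /lG[? ? ? ?]; split => //; apply: le_trans (ltW yz).
  have := H y z ry yc cz zr; lra.
have [y Ay cy] := sup_adherent r0 supA.
have yc : y <= c by apply: ub_le_sup => //; exact: supA.2.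
have [/andP[sy yt] gy] := Ay.
have gc : exists l, good l c.
  move: yc; rewrite le_eqVlt => /predU1P[<-//|yc].
  by apply: (step y c) => //; [exact: ltW|lra].
move: ct; rewrite le_eqVlt => /predU1P[<-//|ct].
pose z := Num.min t (c + r / 2).
have cz : c < z by rewrite lt_min ct; lra.
have zt : z <= t by rewrite ge_min lexx.
have : z <= c.
  apply: ub_le_sup; first exact: supA.2.
  split; first by rewrite zt andbT; lra.
  apply: (step c z) => //; rewrite ?ltW//; first lra.
  by apply: (@le_lt_trans _ _ (c + r / 2)); [rewrite ge_min lexx orbT|lra].
by rewrite leNgt cz.
Qed.

End AbsolutelyContinuous.

(** * Lipschitz primitives *)

#[global] Instance lebesgue_ae_filter (R : realType) :
  Filter (nbhs (almost_everywhere (@lebesgue_measure R))) := ae_filter_ringOfSetsType _.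

Section Primitives.
Variable R : realType.
Implicit Types (s t x y z e d c M : R) (F G f g : R -> R).
Local Notation mu := (@lebesgue_measure R).

Lemma ae_on_and s t (P Q S : R -> Prop) : ae_on s t P -> ae_on s t Q ->
  (forall x, s <= x <= t -> P x -> Q x -> S x) -> ae_on s t S.
Proof.
rewrite /ae_on => aP aQ PQS; apply: filterS2 aP aQ => x Px Qx xst.
by apply: PQS; [rewrite in_itv/= in xst|exact: Px|exact: Qx].
Qed.

Lemma ae_on_imp s t (P S : R -> Prop) : ae_on s t P ->
  (forall x, s <= x <= t -> P x -> S x) -> ae_on s t S.
Proof. by move=> aP PS; apply: (ae_on_and aP aP) => x xst /(PS x xst). Qed.

Lemma ae_on_all s t (P : R -> Prop) : (forall x, s <= x <= t -> P x) -> ae_on s t P.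
Proof. by rewrite /ae_on => H; apply: aeW => x xst; apply: H; rewrite in_itv/= in xst. Qed.

Lemma ae_on_sub s t x y (P : R -> Prop) : s <= x -> y <= t -> ae_on s t P -> ae_on x y P.
Proof.
rewrite /ae_on => sx yt; apply: filterS => z Pz; rewrite in_itv/= => /andP[xz zy].
by apply: Pz; rewrite in_itv/= (le_trans sx xz) (le_trans zy yt).
Qed.

Lemma ae_on_forall (I : finType) s t (P : I -> R -> Prop) :
  (forall i, ae_on s t (P i)) -> ae_on s t (fun x => forall i, P i x).
Proof.
rewrite /ae_on => aP; have : \forall x \ae mu, forall i, i \in enum I -> x \in `[s, t] -> P i x.
  elim: (enum I) => [|i r IH]; first exact: aeW.
  apply: filterS2 (aP i) IH => x Pi IH j; rewrite inE => /predU1P[->//|]; exact: IH.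
by apply: filterS => x H xst i; apply: H => //; rewrite mem_enum.
Qed.

Lemma ae_on_neq s t c (P : R -> Prop) :
  (forall x, s <= x <= t -> x != c -> P x) -> ae_on s t P.
Proof.
move=> H; exists [set c]; split => //; first exact: lebesgue_measure_set1.
move=> x /=; apply: contra_notP => /eqP xc xst; exact: H.
Qed.

Definition lipschitz_itv s t F := exists M, forall x y,
  s <= x <= t -> s <= y <= t -> `|F x - F y| <= M * `|x - y|.

(** Lipschitz primitives. For a bounded potential the solutions and their first
    derivatives are in this class, which is stable under sums, products and
    gluing, and where the fundamental theorem of calculus is [prim_le]. *)
Definition prim s t F f :=
  lipschitz_itv s t F /\ ae_on s t (fun x => is_derive x 1 F (f x)).

Lemma lipschitz_itv_ge0 s t F : lipschitz_itv s t F -> exists2 M, 0 < M &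
  forall x y, s <= x <= t -> s <= y <= t -> `|F x - F y| <= M * `|x - y|.
Proof.
move=> [M H]; exists (`|M| + 1); first by rewrite ltr_wpDl.
move=> x y /H {}H /H {}H; apply: le_trans H _; apply: ler_wpM2r => //.
by rewrite (le_trans (ler_norm _))// lerDl.
Qed.

Lemma lipschitz_itv_abs_continuous s t F : lipschitz_itv s t F -> abs_continuous s t F.
Proof.
move=> /lipschitz_itv_ge0[M M0 H] e e0; exists (e / M); first exact: divr_gt0.
move=> m u v uv _; rewrite ltr_pdivlMr// mulrC mulr_sumr; apply: le_lt_trans.
apply: ler_sum => j _; have [su uv' vt] := uv j.
have := H (v j) (u j); rewrite [X in _ <= _ * X]ger0_norm ?subr_ge0 ?(ltW uv')//.
by apply; apply/andP; split; lra.
Qed.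

Lemma abs_continuousD s t F G : abs_continuous s t F -> abs_continuous s t G ->
  abs_continuous s t (fun x => F x + G x).
Proof.
move=> aF aG e e0.
have [d d0 HF] := aF (e / 2) ltac:(by rewrite divr_gt0).
have [c c0 HG] := aG (e / 2) ltac:(by rewrite divr_gt0).
exists (Num.min d c); first by rewrite lt_min d0.
move=> m u v uv tI; rewrite lt_min => /andP[/(HF _ _ _ uv tI) F1 /(HG _ _ _ uv tI) G1].
rewrite (splitr e); apply: le_lt_trans (ltrD F1 G1).
rewrite -big_split; apply: ler_sum => j _ /=.
by rewrite opprD addrACA; exact: ler_normD.
Qed.

Lemma abs_continuousN s t F : abs_continuous s t F ->
  abs_continuous s t (fun x => - F x).
Proof.
move=> aF e /aF[d d0 H]; exists d => // m u v uv tI /(H _ _ _ uv tI).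
rewrite [in X in _ -> X](eq_bigr (fun j => `|F (v j) - F (u j)|))// => j _.
by rewrite -opprD normrN.
Qed.

Lemma abs_continuous_sub s t x y F : s <= x -> y <= t ->
  abs_continuous s t F -> abs_continuous x y F.
Proof.
move=> sx yt aF e /aF[d d0 H]; exists d => // m u v uv; apply: H => j.
by have [? ? ?] := uv j; split => //; lra.
Qed.

Lemma lipschitz_affine s t M : lipschitz_itv s t (fun x => M * x).
Proof. by exists `|M| => x y _ _; rewrite -mulrBr normrM. Qed.

(** The mean value inequality. *)
Lemma abs_continuous_le s t F f M x y : abs_continuous s t F ->
  ae_on s t (fun x => is_derive x 1 F (f x)) -> ae_on s t (fun x => `|f x| <= M) ->
  s <= x -> x <= y -> y <= t -> `|F y - F x| <= M * (y - x).
Proof.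
move=> aF dF fM sx xy yt.
have aM : abs_continuous x y (fun x => M * x).
  by apply: lipschitz_itv_abs_continuous; exact: lipschitz_affine.
have {}aF := abs_continuous_sub sx yt aF.
have {}dF := ae_on_sub sx yt dF; have {}fM := ae_on_sub sx yt fM.
have dM z : is_derive z 1 (fun x => M * x) M.
  by apply: is_derive_eq; rewrite /GRing.scale/= mulr1.
rewrite ler_norml; apply/andP; split.
- suff : M * x + F x <= M * y + F y by rewrite mulrBr; lra.
  apply: (abs_continuous_nondecreasing xy (abs_continuousD aM aF)).
  apply: ae_on_and dF fM _ => z _ dz; rewrite ler_norml => /andP[fz _].
  by exists (M + f z); [lra|exact: is_deriveD].
- suff : M * x - F x <= M * y - F y by rewrite mulrBr; lra.
  apply: (abs_continuous_nondecreasing xy (abs_continuousD aM (abs_continuousN aF))).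
  apply: ae_on_and dF fM _ => z _ dz; rewrite ler_norml => /andP[_ fz].
  by exists (M - f z); [lra|exact: is_deriveB].
Qed.

Lemma abs_continuous_prim s t F f M : abs_continuous s t F ->
  ae_on s t (fun x => is_derive x 1 F (f x)) -> ae_on s t (fun x => `|f x| <= M) ->
  prim s t F f.
Proof.
move=> aF dF fM; split => //; exists M => x y /andP[sx xt] /andP[sy yt].
have [xy|/ltW yx] := leP x y.
  rewrite distrC; apply: le_trans (abs_continuous_le aF dF fM sx xy yt) _.
  by rewrite ler0_norm ?subr_le0// opprB.
apply: le_trans (abs_continuous_le aF dF fM sy yx xt) _.
by rewrite ger0_norm ?subr_ge0.
Qed.

Lemma prim_dist_le s t F f M x y : prim s t F f -> ae_on s t (fun x => `|f x| <= M) ->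
  s <= x <= t -> s <= y <= t -> `|F y - F x| <= M * `|y - x|.
Proof.
move=> [/lipschitz_itv_abs_continuous aF dF] fM /andP[sx xt] /andP[sy yt].
have [xy|/ltW yx] := leP x y.
  by rewrite (ger0_norm (_ : 0 <= y - x)) ?subr_ge0//; exact: abs_continuous_le fM _ _ _.
rewrite distrC (distrC y) (ger0_norm (_ : 0 <= x - y)) ?subr_ge0//.
exact: abs_continuous_le fM _ _ _.
Qed.

Lemma prim_sub s t x y F f : s <= x -> y <= t -> prim s t F f -> prim x y F f.
Proof.
move=> sx yt [[M H] dF]; split; last exact: ae_on_sub dF.
by exists M => u v uxy vxy; apply: H; lra.
Qed.

Lemma prim_ext s t F f g : prim s t F f -> ae_on s t (fun x => f x = g x) -> prim s t F g.
Proof. by move=> [lF dF] fg; split => //; apply: ae_on_and dF fg _ => x _ + <-. Qed.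

Lemma prim_cst s t c : prim s t (fun=> c) (fun=> 0).
Proof.
split; first by exists 0 => x y _ _; rewrite subrr normr0 mul0r.
by apply: ae_on_all => x _; exact: is_derive_cst.
Qed.

Lemma prim_id s t : prim s t id (fun=> 1).
Proof.
split; first by exists 1 => x y _ _; rewrite mul1r.
by apply: ae_on_all => x _; exact: is_derive_id.
Qed.

Lemma primD s t F G f g : prim s t F f -> prim s t G g ->
  prim s t (fun x => F x + G x) (fun x => f x + g x).
Proof.
move=> [[M HF] dF] [[N HG] dG]; split.
  exists (M + N) => x y xst yst; rewrite opprD addrACA (le_trans (ler_normD _ _))// mulrDl.
  by rewrite lerD ?HF ?HG.
by apply: ae_on_and dF dG _ => x _ ? ?; exact: is_deriveD.
Qed.

Lemma lipschitz_itv_bounded s t F : lipschitz_itv s t F ->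
  exists2 B, 0 < B & forall x, s <= x <= t -> `|F x| <= B.
Proof.
move=> /lipschitz_itv_ge0[M M0 H]; exists (`|F s| + M * `|t - s| + 1).
  by rewrite ltr_wpDl// addr_ge0// mulr_ge0// ltW.
move=> x /[dup] xst /andP[sx xt]; have := H x s xst ltac:(lra) => H1.
have -> : F x = F s + (F x - F s) by ring.
apply: le_trans (ler_normD _ _) _; rewrite -addrA lerD2l.
apply: le_trans H1 _; rewrite ler_wpDr// ler_wpM2l ?(ltW M0)// !ger0_norm; lra.
Qed.

Lemma primM s t F G f g : prim s t F f -> prim s t G g ->
  prim s t (fun x => F x * G x) (fun x => f x * G x + F x * g x).
Proof.
move=> [lF dF] [lG dG]; split; last first.
  apply: ae_on_and dF dG _ => x _ dFx dGx; apply: is_derive_eq (is_deriveM dFx dGx) _.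
  by rewrite /GRing.scale/= addrC mulrC.
have [B B0 FB] := lipschitz_itv_bounded lF.
have [C C0 GC] := lipschitz_itv_bounded lG.
have [M M0 HF] := lipschitz_itv_ge0 lF; have [N N0 HG] := lipschitz_itv_ge0 lG.
exists (C * M + B * N) => x y xst yst.
have -> : F x * G x - F y * G y = G x * (F x - F y) + F y * (G x - G y) by ring.
apply: le_trans (ler_normD _ _) _; rewrite !normrM mulrDl -!mulrA.
by rewrite lerD// ler_pM// ?GC ?FB ?HF ?HG.
Qed.

Lemma primZ s t c F f : prim s t F f -> prim s t (fun x => c * F x) (fun x => c * f x).
Proof.
move=> pF; apply: prim_ext (primM (prim_cst s t c) pF) _.
by apply: ae_on_all => x _; rewrite mul0r add0r.
Qed.

Lemma primB s t F G f g : prim s t F f -> prim s t G g ->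
  prim s t (fun x => F x - G x) (fun x => f x - g x).
Proof.
move=> pF /(primZ (-1)) pG; have := primD pF pG.
by under eq_fun do rewrite mulN1r; under [X in prim _ _ _ X]eq_fun do rewrite mulN1r.
Qed.

Lemma prim_sum s t (I : Type) (r : seq I) (F f : I -> R -> R) :
  (forall i, prim s t (F i) (f i)) ->
  prim s t (fun x => \sum_(i <- r) F i x) (fun x => \sum_(i <- r) f i x).
Proof.
move=> pF; elim: r => [|i r IH].
  under eq_fun do rewrite big_nil; under [X in prim _ _ _ X]eq_fun do rewrite big_nil.
  exact: prim_cst.
under eq_fun do rewrite big_cons; under [X in prim _ _ _ X]eq_fun do rewrite big_cons.
exact: primD.
Qed.

Lemma prim_le s t F G f g : s <= t -> prim s t F f -> prim s t G g ->
  ae_on s t (fun x => f x <= g x) -> F t - F s <= G t - G s.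
Proof.
move=> st pF pG fg; have [lD dD] := primB pG pF.
have := abs_continuous_nondecreasing st (lipschitz_itv_abs_continuous lD).
move=> /(_ _)/wrap[]; last by lra.
by apply: ae_on_and dD fg _ => x _ dx fgx; exists (g x - f x); rewrite ?subr_ge0.
Qed.

End Primitives.

(** * Existence and gluing of primitives *)

Section PrimitiveExists.
Variable R : realType.
Implicit Types (s t x y z e d c M : R) (F G f g : R -> R).
Local Notation mu := (@lebesgue_measure R).

Lemma lipschitz_itv_measurable s t F : lipschitz_itv s t F -> measurable_fun `[s, t] F.
Proof.
move=> /lipschitz_itv_ge0[M M0 H].
apply: subspace_continuous_measurable_fun; first exact: measurable_itv.
apply/subspace_continuousP => x /=; rewrite in_itv/= => xst.
apply/cvgrPdist_le => e e0; suff : \forall y \near x, s <= y <= t -> `|F x - F y| <= e.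
  by apply: filterS => y H' /=; rewrite in_itv/= => /H'.
near=> y => yst; apply: le_trans (H _ _ xst yst) _.
rewrite mulrC -ler_pdivlMr//; near: y.
by apply: cvgr_dist_le => //; rewrite divr_gt0.
Unshelve. all: by end_near.
Qed.

(** The primitive is the Lebesgue integral; that it has the right derivative almost
    everywhere is Lebesgue's differentiation theorem. *)
Lemma prim_exists s t f M : measurable_fun `[s, t] f ->
  ae_on s t (fun x => `|f x| <= M) ->
  exists2 F, F s = 0 & prim s t F f.
Proof.
move=> mf fM.
(* truncating f only changes it on a null set, and makes its integral Lipschitz *)
pose g := (fun x => Num.min (f x) `|M|) \max (fun=> - `|M|).
have mg : measurable_fun `[s, t] g.
  by apply: measurable_maxr => //; apply: measurable_minr.
have gM x : `|g x| <= `|M|.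
  rewrite ler_norml le_max lexx orbT/= ge_max ge_min lexx orbT/=.
  by rewrite (@le_trans _ _ 0)// oppr_le0.
pose h := g \_ `[s, t].
have hM x : `|h x| <= `|M|.
  by rewrite /h patchE; case: ifP => // _; rewrite normr0.
have mh : measurable_fun setT h by apply/(measurable_restrictT _ _).1.
have ig : mu.-integrable `[s, t] (EFin \o g).
  apply: measurable_bounded_integrable => //.
    by rewrite /= lebesgue_measure_itv/=; case: ifP; rewrite -?EFinD ltry.
  by exists `|M|; split; rewrite ?num_real// => N MN x _ /=; apply: le_trans (ltW MN).
have ih (E : set R) : measurable E -> mu.-integrable E (EFin \o h).
  move=> mE; rewrite /h -restrict_EFin; apply/integrable_restrict => //.
  by apply: integrableS ig => //; apply: measurableI.
have loch : locally_integrable [set: R] h by exact: integrable_locally_restrict.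
pose F x := (\int[mu]_(u in [set` Interval (BLeft s) (BRight x)]) h u)%R.
have FB x y : s <= x -> x <= y -> F y - F x = (\int[mu]_(u in `]x, y]) h u)%R.
  by move=> sx xy; rewrite /F Rintegral_itvB//; exact: ih.
have FL x y : s <= x -> x <= y -> `|F y - F x| <= `|M| * (y - x).
  move=> sx xy; rewrite FB//; apply: le_trans (le_normr_Rintegral _ (ih _ _)) _ => //.
  apply: (@le_trans _ _ (\int[mu]_(u in `]x, y]) `|M|)%R).
    apply: le_Rintegral => //.
    - by apply: integrable_norm; exact: ih.
    - apply: measurable_bounded_integrable => //.
      + by rewrite /= lebesgue_measure_itv/=; case: ifP; rewrite -?EFinD ltry.
      + by exists `|M|; split; rewrite ?num_real// => N MN z _ /=; rewrite normr_id ltW.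
  have muxy : mu `]x, y] = (y - x)%:E.
    rewrite lebesgue_measure_itv/= lte_fin; case: ltP => // yx.
    by rewrite (le_anti (_ : x <= y <= x)) ?xy ?yx// subrr.
  have := @Rintegral_cst _ _ _ mu `]x, y] (measurable_itv _) `|M|.
  rewrite [X in _ = _ * fine X]muxy => ->; exact: lexx.
exists F.
  by rewrite /F set_itv1 Rintegral_set1.
split.
  exists `|M| => x y /andP[sx _] /andP[sy _]; have [xy|/ltW yx] := leP x y.
    rewrite distrC; apply: le_trans (FL _ _ sx xy) _.
    by rewrite ler_wpM2l// distrC ler_norm.
  by apply: le_trans (FL _ _ sy yx) _; rewrite ler_wpM2l// ler_norm.
have /= := @FTC1 R h (BLeft s) (fun y => ih _ (measurable_itv _)) loch.
have : ae_on s t (fun x => x != s) by exact: (@ae_on_neq _ s t s).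
rewrite /ae_on in fM * => ns dF; apply: filterS3 fM ns dF => x fM xs dF xst.
have xst' := xst; rewrite in_itv/= in xst'; case/andP: xst' => sx xt.
have sx' : (s%:E < x%:E)%E by rewrite lte_fin lt_neqAle eq_sym (xs xst) sx.
have [dFx vF] := dF sx'.
have -> : f x = h x.
  rewrite /h patchE mem_set// /g/=.
  move/(_ xst): fM => /le_trans /(_ (ler_norm _)); rewrite ler_norml => /andP[f1 f2].
  by rewrite min_l// max_l.
split; first exact: dFx.
by rewrite -derive1E; exact: vF.
Qed.

(** A nonempty interval is not negligible, so zeros occur arbitrarily close to any
    point. *)
Lemma ae_on_lipschitz_eq0 s t F : s < t -> lipschitz_itv s t F ->
  ae_on s t (fun x => F x = 0) -> forall x, s <= x <= t -> F x = 0.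
Proof.
move=> st /lipschitz_itv_ge0[M M0 H] [N [mN N0 NF]] x xst.
apply/eqP; rewrite -normr_eq0; apply/eqP/le_anti; rewrite normr_ge0 andbT.
apply/ler_addgt0Pr => e e0; rewrite add0r.
pose r := e / M; have r0 : 0 < r by rewrite divr_gt0.
pose u := Num.max s (x - r); pose v := Num.min t (x + r).
have uv : u < v.
  have /andP[sx xt] := xst; rewrite /u /v lt_min !gt_max.
  by rewrite -!andbA; apply/and4P; split; lra.
suff [y [yuv Fy]] : exists y, u <= y <= v /\ F y = 0.
  move: yuv; rewrite /u /v ge_max le_min -andbA => /and4P[sy ry yt yr].
  have := H x y xst; rewrite sy yt Fy subr0 => /(_ isT) /le_trans; apply.
  have -> : e = M * r by rewrite /r mulrC divfK// gt_eqF.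
  by rewrite ler_wpM2l ?(ltW M0)// ler_norml; apply/andP; split; lra.
apply: contrapT => nex.
have : (mu `[u, v] <= mu N)%E.
  apply: le_measure; rewrite ?inE//.
  move=> y /=; rewrite in_itv/= => yuv; apply: NF => /= Fy0; apply: nex.
  exists y; split => //; apply: Fy0; rewrite in_itv/=.
  by move: yuv; rewrite /u /v ge_max le_min -andbA => /and4P[-> _ -> _].
by rewrite N0 lebesgue_measure_itv/= lte_fin uv -EFinD lee_fin leNgt subr_gt0 uv.
Qed.

Lemma lipschitz_itv_glue s t w F G : F t = G t -> s <= t -> t <= w ->
  lipschitz_itv s t F -> lipschitz_itv t w G ->
  lipschitz_itv s w (fun x => if x < t then F x else G x).
Proof.
move=> FG st tw /lipschitz_itv_ge0[M M0 HF] /lipschitz_itv_ge0[N N0 HG].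
exists (M + N).
have key x y : s <= x -> x <= y -> y <= w ->
    `|(if x < t then F x else G x) - (if y < t then F y else G y)| <= (M + N) * `|x - y|.
  move=> sx xy yw; rewrite mulrDl.
  have MN0 : (0 <= M * `|x - y|) * (0 <= N * `|x - y|).
    by split; rewrite mulr_ge0// ltW.
  case: (ltP x t) => xt; case: (ltP y t) => yt; last 1 first.
  - by apply: le_trans (HG _ _ _ _) _; rewrite ?xt ?yt ?yw ?(le_trans xy) ?lerDr ?MN0.
  - by apply: le_trans (HF _ _ _ _) _; rewrite ?sx ?(ltW xt) ?(ltW yt) ?(le_trans sx)// lerDl MN0.
  - have -> : F x - G y = (F x - F t) + (G t - G y) by rewrite FG addrA subrK.
    apply: le_trans (ler_normD _ _) _; apply: lerD.
      apply: le_trans (HF _ _ _ _) _; rewrite ?sx ?(ltW xt) ?st ?lexx//.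
      by rewrite ler_wpM2l ?(ltW M0)// !ler0_norm; lra.
    apply: le_trans (HG _ _ _ _) _; rewrite ?yt ?yw ?tw ?lexx//.
    by rewrite ler_wpM2l ?(ltW N0)// !ler0_norm; lra.
  - by move: (lt_le_trans (le_lt_trans xy yt) xt); rewrite ltxx.
move=> x y /andP[sx xw] /andP[sy yw]; have [xy|/ltW yx] := leP x y; first exact: key.
by rewrite distrC (distrC x); exact: key.
Qed.

Lemma prim_glue s t w F G f g : F t = G t -> s <= t -> t <= w ->
  prim s t F f -> prim t w G g ->
  prim s w (fun x => if x < t then F x else G x) (fun x => if x < t then f x else g x).
Proof.
move=> FG st tw [lF dF] [lG dG]; split; first exact: lipschitz_itv_glue.
have nt : ae_on s w (fun x => x != t) by exact: (@ae_on_neq _ s w t).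
have {}dF : ae_on s w (fun x => x <= t -> is_derive x 1 F (f x)).
  rewrite /ae_on in dF *; apply: filterS dF => x Px xsw xt; apply: Px.
  by rewrite !in_itv/= in xsw *; case/andP: xsw => -> _.
have {}dG : ae_on s w (fun x => t <= x -> is_derive x 1 G (g x)).
  rewrite /ae_on in dG *; apply: filterS dG => x Px xsw tx; apply: Px.
  by rewrite !in_itv/= in xsw *; case/andP: xsw => _ ->; rewrite tx.
apply: ae_on_and (ae_on_and dF dG (fun _ _ P Q => conj P Q)) nt _ => x _ [PF PG].
rewrite neq_lt => /orP[xt|tx].
  rewrite xt; apply: near_eq_is_derive (PF (ltW xt)).
  by near=> y; rewrite ifT//; near: y; exact: lt_nbhsl.
rewrite ltNge (ltW tx)/=; apply: near_eq_is_derive (PG (ltW tx)).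
near=> y; rewrite ifF//; apply/negbTE; rewrite -leNgt ltW//; near: y; exact: lt_nbhsr.
Unshelve. all: by end_near.
Qed.

End PrimitiveExists.

(** * Affine interpolation and geometric limits *)

Section ShortIntervalBounds.
Variable R : realType.
Implicit Types (x y z c B C : R) (F G f : R -> R).

(** Affine interpolation between the value [c] at [s] and the value [d] at [t]. *)
Definition affine_itv s t c d x : R := c + (x - s) / (t - s) * (d - c).

Lemma affine_itv_le s t c d x : s <= x <= t -> `|affine_itv s t c d x| <= `|c| + `|d|.
Proof.
move=> /andP[sx xt]; rewrite /affine_itv; set q := _ / _.
have /andP[q0 q1] : 0 <= q <= 1.
  rewrite /q; have [ts|ts] := leP (t - s) 0.
    have -> : x - s = 0 by lra.
    by rewrite mul0r lexx ler01.
  by rewrite divr_ge0 ?(ltW ts) ?subr_ge0//= ler_pdivrMr// mul1r lerD2r.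
clearbody q; have -> : c + q * (d - c) = (1 - q) * c + q * d by ring.
apply: le_trans (ler_normD _ _) _; rewrite !normrM lerD//.
  by rewrite ler_piMl// ger0_norm ?subr_ge0// lerBlDr lerDl.
by rewrite ler_piMl// ger0_norm.
Qed.

(** The slope of the secant is a mean value of [G], whose oscillation is at most
    [C * (t - s)]. *)
Lemma secant_bound s t F G f C : s < t -> prim s t F G -> prim s t G f ->
  ae_on s t (fun x => `|f x| <= C) -> forall x, s <= x <= t ->
  `|G x - (F t - F s) / (t - s)| <= C * (t - s) /\
  `|F x - affine_itv s t (F s) (F t) x| <= C * (t - s) ^+ 2.
Proof.
move=> st pF pG fC; set h := t - s; have h0 : 0 < h by rewrite subr_gt0.
have hN0 : h != 0 by rewrite gt_eqF.
have sst : s <= s <= t by rewrite lexx ltW.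
have tst : s <= t <= t by rewrite lexx ltW.
have Gd x y : s <= x <= t -> s <= y <= t -> `|G y - G x| <= C * h.
  move=> xst yst; apply: le_trans (prim_dist_le pG fC xst yst) _.
  (* C is nonnegative because the bound holds at some point *)
  have [z zst fz] : exists2 z, s <= z <= t & `|f z| <= C.
    apply: contrapT => nz; have fC0 : ae_on s t (fun _ => (1 : R) = 0).
      by apply: ae_on_imp fC _ => z zst fz; exfalso; apply: nz; exists z.
    have /= := @ae_on_lipschitz_eq0 R s t (fun=> 1) st (prim_cst s t 1).1 fC0 s sst.
    by move/eqP; rewrite oner_eq0.
  have C0 : 0 <= C by apply: le_trans fz.
  rewrite ler_wpM2l// ler_norml; move/andP: xst => [? ?]; move/andP: yst => [? ?].
  by rewrite /h; apply/andP; split; lra.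
set q := (F t - F s) / h.
have Gq x : s <= x <= t -> `|G x - q| <= C * h.
  move=> xst; have pE := primB pF (primZ (G x) (prim_id s t)).
  have := prim_dist_le (M := C * h) pE _ sst tst.
  move=> /(_ _)/wrap[].
    by apply: ae_on_all => z zst; rewrite mulr1; exact: Gd.
  rewrite /= -/h (gtr0_norm h0) => H.
  have -> : G x - q = - ((F t - G x * t - (F s - G x * s)) / h).
    by rewrite /q /h; field; rewrite subr_eq0 gt_eqF.
  by rewrite normrN normrM normfV (gtr0_norm h0) ler_pdivrMr.
move=> x xst; split; first exact: Gq.
have pE := primB pF (primZ q (prim_id s t)).
have := prim_dist_le (M := C * h) pE _ sst xst.
move=> /(_ _)/wrap[].
  by apply: ae_on_all => z zst; rewrite mulr1; exact: Gq.
have -> : F x - q * id x - (F s - q * id s) = F x - affine_itv s t (F s) (F t) x.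
  by rewrite /affine_itv /q /h /=; field; rewrite subr_eq0 gt_eqF.
move=> /le_trans; apply; rewrite expr2 mulrA ler_wpM2l//.
  by apply: le_trans (Gq _ sst).
by move/andP: xst => [? ?]; rewrite ger0_norm ?subr_ge0// lerD2r.
Qed.

Lemma geometric_small x B : (forall j : nat, x <= B / 2 ^+ j) -> x <= 0.
Proof.
move=> H; rewrite leNgt; apply/negP => x0.
have B0 : 0 < B by apply: lt_le_trans x0 _; have := H 0%N; rewrite expr0 divr1.
have [j Bj] : exists j : nat, B / x < j%:R.
  by exists (Num.truncn (B / x)).+1; rewrite truncnS_gt.
have := H j; rewrite leNgt => /negP; apply.
rewrite ltr_pdivrMr ?exprn_gt0// mulrC -ltr_pdivrMr//; apply: lt_le_trans Bj _.
by rewrite -natrX ler_nat ltnW// ltn_expl.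
Qed.

(** The limit is the supremum of the sequence [v j - 2 * C / 2 ^+ j], which is
    nondecreasing, whereas [v j + 2 * C / 2 ^+ j] is nonincreasing. *)
Lemma geometric_limit (v : nat -> R) C :
  (forall j, `|v j.+1 - v j| <= C / 2 ^+ j) ->
  exists u, forall j, `|u - v j| <= 2 * C / 2 ^+ j.
Proof.
move=> H; pose e j : R := 2 * C / 2 ^+ j.
have eS j : e j = e j.+1 + C / 2 ^+ j.
  by rewrite /e exprS invfM; field; rewrite expf_neq0.
have C0 : 0 <= C by have := H 0%N; rewrite expr0 divr1; apply: le_trans.
have e0 j : 0 <= e j by rewrite divr_ge0 ?mulr_ge0.
have low k j : (j <= k)%N -> v j - e j <= v k - e k.
  elim: k => [|k IH]; first by rewrite leqn0 => /eqP ->.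
  rewrite leq_eqVlt => /predU1P[->//|/IH] /le_trans; apply.
  by have := H k; rewrite ler_norml (eS k) => /andP[]; lra.
have upp k j : (j <= k)%N -> v k + e k <= v j + e j.
  elim: k => [|k IH]; first by rewrite leqn0 => /eqP ->.
  rewrite leq_eqVlt => /predU1P[->//|/IH]; apply: le_trans.
  by have := H k; rewrite ler_norml (eS k) => /andP[]; lra.
have lu k j : v k - e k <= v j + e j.
  have [jk|/ltnW kj] := leqP j k.
    by apply: le_trans (upp _ _ jk); have := e0 k; lra.
  by apply: le_trans (low _ _ kj) _; have := e0 j; lra.
pose A := [set x | exists k, x = v k - e k].
have supA : has_sup A.
  by split; [exists (v 0%N - e 0%N); exists 0%N|exists (v 0%N + e 0%N) => x [k ->]].
exists (sup A) => j; rewrite -/(e j) ler_norml; apply/andP; split.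
  suff : v j - e j <= sup A by lra.
  by apply: ub_le_sup; [exact: supA.2|exists j].
suff : sup A <= v j + e j by lra.
by apply: ge_sup; [exact: supA.1|move=> x [k ->]].
Qed.

End ShortIntervalBounds.

(** * The Schrodinger equation *)

(** The right-hand side (V - l) v of the Schrodinger equation u'' = (V - l) u. *)
Definition sch_rhs (R : realType) n (V : R -> 'M[R]_n) (l : R) (v : 'I_n -> R -> R)
    (i : 'I_n) (x : R) : R := \sum_k V x i k * v k x - l * v i x.

Definition sch_sol (R : realType) n (s t : R) (V : R -> 'M[R]_n) (l : R)
    (u u1 : 'I_n -> R -> R) : Prop :=
  forall i, prim s t (u i) (u1 i) /\ prim s t (u1 i) (sch_rhs V l u i).

Section Solutions.
Variables (R : realType) (n : nat) (V : R -> 'M[R]_n).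
Implicit Types (s t x y l c : R) (u v : 'I_n -> R -> R).

Lemma sch_rhs_comb l c v w i x :
  sch_rhs V l (fun k y => v k y + c * w k y) i x = sch_rhs V l v i x + c * sch_rhs V l w i x.
Proof.
rewrite /sch_rhs mulrBr mulr_sumr.
under eq_bigr do rewrite mulrDr mulrCA.
by rewrite big_split/=; ring.
Qed.

Lemma sch_rhsB l v w i x :
  sch_rhs V l (fun k y => v k y - w k y) i x = sch_rhs V l v i x - sch_rhs V l w i x.
Proof.
have := sch_rhs_comb l (-1) v w i x; rewrite mulN1r => <-.
by congr (sch_rhs V l _ i x); apply/funext => k; apply/funext => y; rewrite mulN1r.
Qed.

Lemma eq_sch_rhs l v w i x : (forall k, v k x = w k x) ->
  sch_rhs V l v i x = sch_rhs V l w i x.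
Proof. by move=> vw; rewrite /sch_rhs vw; under eq_bigr do rewrite vw. Qed.

Lemma sch_sol_comb s t l c u u1 v v1 : sch_sol s t V l u u1 -> sch_sol s t V l v v1 ->
  sch_sol s t V l (fun i x => u i x + c * v i x) (fun i x => u1 i x + c * v1 i x).
Proof.
move=> su sv i; have [pu pu1] := su i; have [pv pv1] := sv i; split.
  exact: primD pu (primZ c pv).
apply: prim_ext (primD pu1 (primZ c pv1)) _.
by apply: ae_on_all => x _; rewrite sch_rhs_comb.
Qed.

Lemma sch_sol0 s t l : sch_sol s t V l (fun=> fun=> 0) (fun=> fun=> 0).
Proof.
move=> i; split; first exact: prim_cst.
apply: prim_ext (prim_cst s t 0) _; apply: ae_on_all => x _.
by rewrite /sch_rhs mulr0 subr0 big1// => k _; rewrite mulr0.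
Qed.

Lemma sch_sol_sum s t l (I : Type) (r : seq I) (c : I -> R) (u u1 : I -> 'I_n -> R -> R) :
  (forall j, sch_sol s t V l (u j) (u1 j)) ->
  sch_sol s t V l (fun i x => \sum_(j <- r) c j * u j i x)
    (fun i x => \sum_(j <- r) c j * u1 j i x).
Proof.
move=> su; elim: r => [|j r IH].
  have := sch_sol0 s t l.
  by congr (sch_sol s t V l _ _); apply/funext => i; apply/funext => x; rewrite big_nil.
suff E (w : I -> 'I_n -> R -> R) : (fun i x => \sum_(k <- j :: r) c k * w k i x) =
    (fun i x => \sum_(k <- r) c k * w k i x + c j * w j i x).
  by rewrite !E; exact: sch_sol_comb.
by apply/funext => i; apply/funext => x; rewrite big_cons; exact: addrC.
Qed.

Lemma sch_sol_sub s t x y l u u1 : s <= x -> y <= t ->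
  sch_sol s t V l u u1 -> sch_sol x y V l u u1.
Proof. by move=> sx yt su i; have [pu pu1] := su i; split; exact: (prim_sub sx yt). Qed.

(** Lagrange's identity: as [V] is symmetric, it cancels in (u' . v - u . v')'. *)
Lemma lagrange_identity s t l m u u1 v v1 : ae_on s t (fun x => V x = (V x)^T) ->
  sch_sol s t V l u u1 -> sch_sol s t V m v v1 ->
  prim s t (fun x => \sum_i (u1 i x * v i x - u i x * v1 i x))
    (fun x => (m - l) * \sum_i u i x * v i x).
Proof.
move=> Vs su sv.
have pi i := primB (primM (su i).2 (sv i).1) (primM (su i).1 (sv i).2).
apply: prim_ext (prim_sum _ pi) _; apply: ae_on_imp Vs _ => x _ Vx.
have -> : \sum_i (sch_rhs V l u i x * v i x + u1 i x * v1 i x -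
    (u1 i x * v1 i x + u i x * sch_rhs V m v i x)) =
  \sum_i (\sum_k V x i k * u k x * v i x - \sum_k V x i k * u i x * v k x
     + (m - l) * (u i x * v i x)).
  apply: eq_bigr => i _; rewrite /sch_rhs mulrBl mulrBr mulr_suml mulr_sumr.
  have -> : \sum_k u i x * (V x i k * v k x) = \sum_k V x i k * u i x * v k x.
    by apply: eq_bigr => k _; ring.
  by ring.
rewrite big_split/= -mulr_sumr sumrB.
rewrite [X in X - _ + _]exchange_big/=.
rewrite [X in X - _ + _](eq_bigr (fun i => \sum_k V x i k * u i x * v k x)).
  by rewrite subrr add0r.
by move=> i _; apply: eq_bigr => k _; rewrite [in LHS]Vx mxE.
Qed.

(** The derivative of u' . u is the density |u'|^2 + (V - l) u . u of the quadratic
    form of the operator. *)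
Lemma energy_identity s t l u u1 : sch_sol s t V l u u1 ->
  prim s t (fun x => \sum_i u1 i x * u i x)
    (fun x => \sum_i (u1 i x ^+ 2 + sch_rhs V l u i x * u i x)).
Proof.
move=> su; have pi i := primM (su i).2 (su i).1.
apply: prim_ext (prim_sum _ pi) _; apply: ae_on_all => x _.
by apply: eq_bigr => i _; rewrite expr2 addrC.
Qed.

Lemma sch_rhs_bound s t l M B v : ae_on s t (fun x => forall i k, `|V x i k| <= M) ->
  (forall i x, s <= x <= t -> `|v i x| <= B) ->
  forall i, ae_on s t (fun x => `|sch_rhs V l v i x| <= (n%:R * M + `|l|) * B).
Proof.
move=> VM vB i; apply: ae_on_imp VM _ => x xst VM.
rewrite /sch_rhs mulrDl; apply: le_trans (ler_normB _ _) _; apply: lerD.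
  apply: le_trans (ler_norm_sum _ _ _) _.
  apply: le_trans (_ : \sum_(k < n) M * B <= _); last first.
    by rewrite sumr_const card_ord -mulrA mulr_natl.
  by apply: ler_sum => k _; rewrite normrM ler_pM// vB.
by rewrite normrM ler_wpM2l// vB.
Qed.

Lemma sch_rhs_measurable s t l v : (forall i k, measurable_fun `[s, t] (fun x => V x i k)) ->
  (forall i, lipschitz_itv s t (v i)) ->
  forall i, measurable_fun `[s, t] (sch_rhs V l v i).
Proof.
move=> mV lv i; have mv k := lipschitz_itv_measurable (lv k).
apply: measurable_funB; last by apply: measurable_funM => //; exact: measurable_cst.
by apply: measurable_sum => k; apply: measurable_funM.
Qed.

End Solutions.

(** * The boundary value problem on a short interval *)

(** When K (t - s)^2 is small, where [K] bounds the size of V - l, the map which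
    sends [v] to the solution of w'' = (V - l) v with given values at [s] and [t]
    is a contraction for the supremum norm. The factor 144 is what
    [dtn_decreasing] asks for. *)
Section ShortInterval.
Variables (R : realType) (n : nat) (s t : R) (V : R -> 'M[R]_n) (M K : R).
Hypothesis st : s < t.
Hypothesis K0 : 0 <= K.
Hypothesis VM : ae_on s t (fun x => forall i k, `|V x i k| <= M).
Hypothesis mV : forall i k, measurable_fun `[s, t] (fun x => V x i k).
Hypothesis small : 144 * n.+1%:R * (K * (t - s) ^+ 2) <= 1.
Implicit Types (x y l c B S : R) (u v w : 'I_n -> R -> R).

Let kap := K * (t - s) ^+ 2.

Let kap0 : 0 <= kap. Proof. by rewrite mulr_ge0// sqr_ge0. Qed.

Let kap_small : 144 * kap <= 1.
Proof.
apply: le_trans small; rewrite -/kap ler_wpM2r//.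
by rewrite ler_peMr// ler1n.
Qed.

(* [w] solves w'' = (V - l) v, an explicit problem when v is given *)
Let step_sol l v w w1 := forall i, prim s t (w i) (w1 i) /\ prim s t (w1 i) (sch_rhs V l v i).

Lemma step_secant l v w w1 B : n%:R * M + `|l| <= K -> step_sol l v w w1 -> 0 <= B ->
  (forall i x, s <= x <= t -> `|v i x| <= B) ->
  forall i x, s <= x <= t -> `|w1 i x - (w i t - w i s) / (t - s)| <= K * B * (t - s) /\
    `|w i x - affine_itv s t (w i s) (w i t) x| <= kap * B.
Proof.
move=> lK sw B0 vB i x xst; have [pw pw1] := sw i.
have := secant_bound st pw pw1 _ xst (C := K * B).
move=> /(_ _)/wrap[].
  apply: ae_on_imp (sch_rhs_bound l VM vB i) _ => y _ /le_trans; apply.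
  by rewrite ler_wpM2r.
by move=> [H1 H2]; split; rewrite // /kap mulrAC.
Qed.

Lemma step_exists l v (a b : 'I_n -> R) : (forall i, lipschitz_itv s t (v i)) ->
  exists w w1, [/\ step_sol l v w w1, forall i, w i s = a i & forall i, w i t = b i].
Proof.
move=> lv.
have [B vB] : exists B, forall i x, s <= x <= t -> `|v i x| <= B.
  have /choice[B vB] : forall i, exists B, forall x, s <= x <= t -> `|v i x| <= B.
    by move=> i; have [B _ vB] := lipschitz_itv_bounded (lv i); exists B.
  exists (\sum_i `|B i|) => i x xst; apply: le_trans (vB i x xst) _.
  by rewrite (bigD1 i)//= (le_trans (ler_norm _))// lerDl sumr_ge0.
suff : forall i, exists w : (R -> R) * (R -> R), [/\ prim s t w.1 w.2,
    prim s t w.2 (sch_rhs V l v i), w.1 s = a i & w.1 t = b i].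
  move=> /choice[w Hw]; exists (fun i => (w i).1), (fun i => (w i).2).
  by split=> i; have [? ? ? ?] := Hw i.
move=> i.
have [G Gs pG] := prim_exists (sch_rhs_measurable l mV lv i) (sch_rhs_bound l VM vB i).
have [C C0 GC] := lipschitz_itv_bounded pG.1.
have [F Fs pF] := prim_exists (lipschitz_itv_measurable pG.1) (ae_on_all GC).
pose c := (b i - a i - F t) / (t - s).
exists (fun x => F x + (a i + c * (x - s)), fun x => G x + (0 + c * (1 - 0))); split => /=.
- apply: primD pF (primD (prim_cst _ _ _) (primZ c (primB (prim_id _ _) (prim_cst _ _ s)))).
- apply: prim_ext (primD pG (prim_cst _ _ _)) _.
  by apply: ae_on_all => x _; rewrite addr0.
- by rewrite Fs subrr mulr0 addr0 add0r.
- by rewrite /c divfK ?subr_eq0 ?gt_eqF//; ring.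
Qed.

Lemma step_diff l v w w1 v' w' w1' B : n%:R * M + `|l| <= K ->
  step_sol l v w w1 -> step_sol l v' w' w1' ->
  (forall i, w i s = w' i s) -> (forall i, w i t = w' i t) -> 0 <= B ->
  (forall i x, s <= x <= t -> `|v i x - v' i x| <= B) ->
  forall i x, s <= x <= t -> `|w i x - w' i x| <= kap * B.
Proof.
move=> lK sw sw' ws wt B0 vB i x xst.
have sd : step_sol l (fun i x => v i x - v' i x) (fun i x => w i x - w' i x)
    (fun i x => w1 i x - w1' i x).
  move=> j; have [pw pw1] := sw j; have [pw' pw1'] := sw' j; split; first exact: primB.
  by apply: prim_ext (primB pw1 pw1') _; apply: ae_on_all => y _; rewrite sch_rhsB.
have [_] := step_secant lK sd B0 vB i xst.
by rewrite /affine_itv /= ws wt !subrr mulr0 addr0 subr0.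
Qed.

(** The supremum B of |u| satisfies B <= S + kap B with kap <= 1/2. *)
Lemma sol_bound l u u1 S : n%:R * M + `|l| <= K -> sch_sol s t V l u u1 ->
  (forall i, `|u i s| + `|u i t| <= S) -> forall i x, s <= x <= t -> `|u i x| <= 2 * S.
Proof.
move=> lK su uS i x xst.
pose A := [set y | exists j z, s <= z <= t /\ y = `|u j z|].
have supA : has_sup A.
  split; first by exists `|u i x|, i, x.
  have /choice[B vB] : forall i, exists B, forall x, s <= x <= t -> `|u i x| <= B.
    by move=> j; have [B _ uB] := lipschitz_itv_bounded (su j).1.1; exists B.
  exists (\sum_i `|B i|) => _ [j [z [zst ->]]]; apply: le_trans (vB j z zst) _.
  by rewrite (bigD1 j)//= (le_trans (ler_norm _))// lerDl sumr_ge0.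
have uA j z : s <= z <= t -> `|u j z| <= sup A.
  by move=> zst; apply: ub_le_sup; [exact: supA.2|exists j, z].
have A0 : 0 <= sup A by apply: le_trans (uA i x xst).
suff : sup A <= S + kap * sup A.
  move=> H; apply: le_trans (uA i x xst) _.
  by have := kap_small; have := kap0; nra.
apply: ge_sup; first exact: supA.1.
move=> _ [j [z [zst ->]]].
have [_ H] := step_secant lK su A0 uA j zst.
have -> : u j z = affine_itv s t (u j s) (u j t) z + (u j z - affine_itv s t (u j s) (u j t) z).
  by rewrite addrC subrK.
apply: le_trans (ler_normD _ _) _; rewrite lerD//.
by apply: le_trans (affine_itv_le _ _ zst) (uS j).
Qed.

(** The case [v = u], [B = 2 * S] of [step_secant]: on a short interval solutions
    are nearly affine. *)
Lemma sol_affine l u u1 S : n%:R * M + `|l| <= K -> sch_sol s t V l u u1 ->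
  (forall i, `|u i s| + `|u i t| <= S) -> forall i x, s <= x <= t ->
  `|u i x - affine_itv s t (u i s) (u i t) x| <= 2 * kap * S.
Proof.
move=> lK su uS i x xst.
have S0 : 0 <= 2 * S by apply: le_trans (sol_bound lK su uS i xst).
have [_ H] := step_secant lK su S0 (sol_bound lK su uS) i xst.
by apply: le_trans H _; rewrite mulrCA mulrA.
Qed.

(** Uniqueness for the boundary value problem, by linearity. *)
Lemma sol_eq0 l u u1 : n%:R * M + `|l| <= K -> sch_sol s t V l u u1 ->
  (forall i, u i s = 0) -> (forall i, u i t = 0) ->
  forall i x, s <= x <= t -> u i x = 0 /\ u1 i x = 0.
Proof.
move=> lK su us ut.
have u0 i x : s <= x <= t -> `|u i x| <= 0.
  move=> xst; have uS j : `|u j s| + `|u j t| <= 0 by rewrite us ut normr0 addr0.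
  by have := sol_bound lK su uS i xst; rewrite mulr0.
move=> i x xst; have [H _] := step_secant lK su (lexx 0) u0 i xst.
split; first by apply/eqP; rewrite -normr_le0 u0.
move: H; rewrite us ut subrr mul0r subr0 mulr0 mul0r => H.
by apply/eqP; rewrite -normr_le0.
Qed.

(** Existence for the boundary value problem, by successive approximation. *)
Lemma sol_exists l (a b : 'I_n -> R) : n%:R * M + `|l| <= K ->
  exists u u1, [/\ sch_sol s t V l u u1, forall i, u i s = a i & forall i, u i t = b i].
Proof.
move=> lK.
have /choice[T HT] : forall v, exists w : ('I_n -> R -> R) * ('I_n -> R -> R),
    (forall i, lipschitz_itv s t (v i)) ->
    [/\ step_sol l v w.1 w.2, forall i, w.1 i s = a i & forall i, w.1 i t = b i].
  move=> v; have [lv|nlv] := pselect (forall i, lipschitz_itv s t (v i)).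
    by have [w [w1 H]] := step_exists l a b lv; exists (w, w1).
  by exists (v, v).
pose S := \sum_i (`|a i| + `|b i|).
have S0 : 0 <= S by apply: sumr_ge0 => i _; rewrite addr_ge0.
have abS i : `|a i| + `|b i| <= S.
  by rewrite /S (bigD1 i)//= lerDl sumr_ge0// => j _; rewrite addr_ge0.
pose v j := iter j (fun v => (T v).1) (fun i x => affine_itv s t (a i) (b i) x).
have lv j i : lipschitz_itv s t (v j i).
  elim: j i => [|j IH] i /=; last by have [sT _ _] := HT _ IH; exact: (sT i).1.1.
  have := primD (prim_cst s t (a i)) (primM (primZ (t - s)^-1 (primB (prim_id s t)
    (prim_cst s t s))) (prim_cst s t (b i - a i))).
  case=> + _; congr (lipschitz_itv _ _ _); apply/funext => x.
  by rewrite /affine_itv [_^-1 * _]mulrC.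
have vT j : [/\ step_sol l (v j) (v j.+1) (T (v j)).2, forall i, v j.+1 i s = a i
    & forall i, v j.+1 i t = b i] by exact: HT (lv j).
have vS j i x : s <= x <= t -> `|v j i x| <= 2 * S.
  elim: j i x => [|j IH] i x xst.
    by apply: le_trans (affine_itv_le _ _ xst) _; have := abS i; lra.
  have [sT vs vt] := vT j; have S20 : 0 <= 2 * S by rewrite mulr_ge0.
  have [_] := step_secant lK sT S20 IH i xst; rewrite vs vt => H.
  have := affine_itv_le (a i) (b i) xst; have := abS i.
  have := ler_normD (v j.+1 i x - affine_itv s t (a i) (b i) x) (affine_itv s t (a i) (b i) x).
  rewrite subrK; have := kap_small; nra.
pose C := 4 * S.
have dv j i x : s <= x <= t -> `|v j.+1 i x - v j i x| <= C / 2 ^+ j.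
  elim: j i x => [|j IH] i x xst.
    rewrite expr0 divr1 /C; apply: le_trans (ler_normB _ _) _.
    by have := vS 1%N i x xst; have := vS 0%N i x xst; lra.
  have [sT vs vt] := vT j; have [sT' vs' vt'] := vT j.+1.
  have C0 : 0 <= C / 2 ^+ j by rewrite /C !mulr_ge0// invr_ge0 exprn_ge0.
  apply: le_trans (step_diff lK sT' sT _ _ C0 IH i xst) _.
  - by move=> k; rewrite vs vs'.
  - by move=> k; rewrite vt vt'.
  - have -> : C / 2 ^+ j.+1 = C / 2 ^+ j * 2^-1 by rewrite exprSr invfM mulrA.
    by rewrite mulrC ler_wpM2l//; have := kap_small; have := kap0; lra.
have /choice[u uv] : forall i, exists ui, forall x, s <= x <= t ->
    forall j, `|ui x - v j i x| <= 2 * C / 2 ^+ j.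
  move=> i; have /choice[ui Hui] : forall x, exists y, s <= x <= t ->
      forall j, `|y - v j i x| <= 2 * C / 2 ^+ j.
    move=> x; have [xst|nx] := pselect (s <= x <= t); last by exists 0.
    by have [y Hy] := geometric_limit (fun j => dv j i x xst); exists y.
  by exists ui.
(* the iterates have a common Lipschitz constant L, which passes to the limit *)
have lu i : lipschitz_itv s t (u i).
  pose L := `|b i - a i| / (t - s) + K * (2 * S) * (t - s).
  exists L => x y xst yst; rewrite -subr_le0; apply: (@geometric_small _ _ (4 * C)) => j.
  have [sT vs vt] := vT j; have S20 : 0 <= 2 * S by rewrite mulr_ge0.
  have := prim_dist_le (M := L) (sT i).1 _ yst xst; move=> /(_ _)/wrap[].
    apply: ae_on_all => z zst; have [+ _] := step_secant lK sT S20 (vS j) i zst.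
    rewrite vs vt => H; have -> : (T (v j)).2 i z =
      (b i - a i) / (t - s) + ((T (v j)).2 i z - (b i - a i) / (t - s)) by ring.
    apply: le_trans (ler_normD _ _) _; rewrite /L lerD//.
    by rewrite normrM normfV (gtr0_norm (_ : 0 < t - s)) ?subr_gt0.
  move=> H; have Hx := uv i x xst j.+1; have Hy := uv i y yst j.+1.
  have -> : u i x - u i y = (u i x - v j.+1 i x) + (v j.+1 i x - v j.+1 i y)
    - (u i y - v j.+1 i y) by ring.
  have := ler_normB ((u i x - v j.+1 i x) + (v j.+1 i x - v j.+1 i y)) (u i y - v j.+1 i y).
  have := ler_normD (u i x - v j.+1 i x) (v j.+1 i x - v j.+1 i y).
  move: Hx Hy; rewrite exprS invfM; have -> : 2 * C * (2^-1 / 2 ^+ j) = C / 2 ^+ j.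
    by field; rewrite expf_neq0.
  have C0 : 0 <= C / 2 ^+ j by rewrite /C !mulr_ge0// invr_ge0 exprn_ge0.
  rewrite -[4 * C / _]mulrA; lra.
have [sT us ut] := HT u lu; set w := (T u).1 in sT us ut; set w1 := (T u).2 in sT.
exists w, w1; split=> // i; split; first exact: (sT i).1.
apply: prim_ext (sT i).2 _; apply: ae_on_all => x xst; apply: eq_sch_rhs => k.
apply/eqP; rewrite -subr_eq0 -normr_le0; apply/(@geometric_small _ _ (4 * C)) => j.
have [sTj vs vt] := vT j.
have C0 : 0 <= C / 2 ^+ j by rewrite /C !mulr_ge0// invr_ge0 exprn_ge0.
have C20 : 0 <= 2 * C / 2 ^+ j by rewrite -mulrA mulr_ge0.
have := step_diff lK sT sTj _ _ C20 (fun i x xst => uv i x xst j) k xst.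
move=> /(_ _ _)/wrap[||H].
- by move=> i'; rewrite us vs.
- by move=> i'; rewrite ut vt.
have := uv k x xst j.+1; rewrite exprS invfM.
have -> : 2 * C * (2^-1 / 2 ^+ j) = C / 2 ^+ j by field; rewrite expf_neq0.
have := ler_normB (u k x - v j.+1 k x) (w k x - v j.+1 k x).
have -> : u k x - v j.+1 k x - (w k x - v j.+1 k x) = u k x - w k x by ring.
have : kap * (2 * C / 2 ^+ j) <= 2 * C / 2 ^+ j.
  by rewrite ler_piMl//; have := kap_small; lra.
have -> : 2 * C / 2 ^+ j = 2 * (C / 2 ^+ j) by rewrite mulrA.
have -> : 4 * C / 2 ^+ j = 4 * (C / 2 ^+ j) by rewrite mulrA.
move: H; have -> : 2 * C / 2 ^+ j = 2 * (C / 2 ^+ j) by rewrite mulrA.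
lra.
Qed.

End ShortInterval.

(** * The Dirichlet-to-Neumann matrix of a short interval *)

Lemma sqr_sum_le (F : realFieldType) (I : finType) (a : I -> F) :
  (\sum_i a i) ^+ 2 <= #|I|%:R * \sum_i a i ^+ 2.
Proof.
rewrite expr2 mulr_suml.
apply: le_trans (_ : \sum_i \sum_j (a i ^+ 2 + a j ^+ 2) / 2 <= _).
  apply: ler_sum => i _; rewrite mulr_sumr; apply: ler_sum => j _.
  have := sqr_ge0 (a i - a j); rewrite sqrrB; lra.
set S := \sum_i a i ^+ 2.
have Ei i : \sum_j (a i ^+ 2 + a j ^+ 2) / 2 = (#|I|%:R * a i ^+ 2 + S) / 2.
  by rewrite -mulr_suml big_split/= sumr_const mulr_natl.
under eq_bigr do rewrite Ei.
by rewrite -mulr_suml big_split/= sumr_const -mulr_sumr -/S -[S *+ _]mulr_natl; lra.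
Qed.

Lemma prim_affine_sqr (R : realType) (s t c d : R) : s < t ->
  exists2 F, prim s t F (fun x => affine_itv s t c d x ^+ 2) &
    F t - F s = (t - s) / 3 * (c ^+ 2 + c * d + d ^+ 2).
Proof.
move=> st; have h0 : t - s != 0 by rewrite subr_eq0 gt_eqF.
pose h := t - s; have p1 := primZ h^-1 (primB (prim_id s t) (prim_cst s t s)).
have p2 := primM p1 p1; have p3 := primM p2 p1.
have := primD (primZ (h * c ^+ 2) p1) (primD (primZ (h * (c * (d - c))) p2)
  (primZ (h * (d - c) ^+ 2 / 3) p3)).
set F := fun x => _ => pF; exists F; last by rewrite /F /h/=; field.
by apply: prim_ext pF _; apply: ae_on_all => x _; rewrite /affine_itv /h/=; field.
Qed.

Section DirichletToNeumann.
Variables (R : realType) (n : nat) (s t : R) (V : R -> 'M[R]_n) (M K : R).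
Hypothesis st : s < t.
Hypothesis K0 : 0 <= K.
Hypothesis M0 : 0 <= M.
Hypothesis VM : ae_on s t (fun x => forall i k, `|V x i k| <= M).
Hypothesis mV : forall i k, measurable_fun `[s, t] (fun x => V x i k).
Hypothesis Vsym : ae_on s t (fun x => V x = (V x)^T).
Hypothesis small : 144 * n.+1%:R * (K * (t - s) ^+ 2) <= 1.
Implicit Types (x y l m c B S : R) (u v w : 'I_n -> R -> R) (E : 'M[R]_(n + n)).

Definition dirichlet_data u : 'rV[R]_(n + n) := row_mx (\row_i u i s) (\row_i u i t).

(** The derivatives are outward normal ones, hence the sign at [s]. *)
Definition neumann_data u1 : 'rV[R]_(n + n) := row_mx (\row_i - u1 i s) (\row_i u1 i t).

Definition dtn_matrix l E := forall u u1, sch_sol s t V l u u1 ->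
  neumann_data u1 = dirichlet_data u *m E.

Lemma dirichlet_dataE u i : (dirichlet_data u 0 (lshift n i) = u i s) *
  (dirichlet_data u 0 (rshift n i) = u i t).
Proof. by rewrite /dirichlet_data row_mxEl row_mxEr !mxE. Qed.

Lemma neumann_dataE u i : (neumann_data u 0 (lshift n i) = - u i s) *
  (neumann_data u 0 (rshift n i) = u i t).
Proof. by rewrite /neumann_data row_mxEl row_mxEr !mxE. Qed.

Lemma eq_row_split (z z' : 'rV[R]_(n + n)) :
  (forall i, z 0 (lshift n i) = z' 0 (lshift n i)) ->
  (forall i, z 0 (rshift n i) = z' 0 (rshift n i)) -> z = z'.
Proof.
move=> zl zr; apply/rowP => p; rewrite -(splitK p); case: (fintype.split p) => i.
  exact: zl.
exact: zr.
Qed.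

Lemma dirichlet_data_sum (I : Type) (r : seq I) (c : I -> R) (u : I -> 'I_n -> R -> R) :
  dirichlet_data (fun i x => \sum_(j <- r) c j * u j i x) =
  \sum_(j <- r) c j *: dirichlet_data (u j).
Proof.
by apply: eq_row_split => i; rewrite dirichlet_dataE summxE; apply: eq_bigr => j _;
  rewrite mxE dirichlet_dataE.
Qed.

Lemma neumann_data_sum (I : Type) (r : seq I) (c : I -> R) (u : I -> 'I_n -> R -> R) :
  neumann_data (fun i x => \sum_(j <- r) c j * u j i x) =
  \sum_(j <- r) c j *: neumann_data (u j).
Proof.
apply: eq_row_split => i; rewrite neumann_dataE summxE -?sumrN; apply: eq_bigr => j _;
  by rewrite mxE neumann_dataE ?mulrN.
Qed.

Lemma dirichlet_data_exists l (z : 'rV[R]_(n + n)) : n%:R * M + `|l| <= K ->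
  exists u u1, sch_sol s t V l u u1 /\ dirichlet_data u = z.
Proof.
move=> lK; have [u [u1 [su us ut]]] := sol_exists st K0 VM mV small
  (fun i => z 0 (lshift n i)) (fun i => z 0 (rshift n i)) lK.
by exists u, u1; split => //; apply: eq_row_split => i; rewrite dirichlet_dataE.
Qed.

Lemma dtn_matrix_exists l : n%:R * M + `|l| <= K -> exists E, dtn_matrix l E.
Proof.
move=> lK; have /choice[w Hw] : forall p : 'I_(n + n),
    exists w : ('I_n -> R -> R) * ('I_n -> R -> R),
    sch_sol s t V l w.1 w.2 /\ dirichlet_data w.1 = delta_mx 0 p.
  by move=> p; have [u [u1 H]] := dirichlet_data_exists (delta_mx 0 p) lK; exists (u, u1).
exists (\matrix_p neumann_data (w p).2) => u u1 su.
pose z := dirichlet_data u.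
have sv := sch_sol_sum (index_enum 'I_(n + n)) (z 0) (fun p => (Hw p).1).
have zE : dirichlet_data (fun i x => \sum_p z 0 p * (w p).1 i x) = z.
  by rewrite dirichlet_data_sum {2}[z]row_sum_delta; apply: eq_bigr => p _; rewrite (Hw p).2.
have sd := sch_sol_comb (-1) su sv.
have ds i : u i s + -1 * (\sum_p z 0 p * (w p).1 i s) = 0.
  have := congr1 (fun y : 'rV_(n + n) => y 0 (lshift n i)) zE.
  by rewrite !dirichlet_dataE mulN1r => ->; rewrite subrr.
have dt i : u i t + -1 * (\sum_p z 0 p * (w p).1 i t) = 0.
  have := congr1 (fun y : 'rV_(n + n) => y 0 (rshift n i)) zE.
  by rewrite !dirichlet_dataE mulN1r => ->; rewrite subrr.
have H i x : s <= x <= t -> u1 i x + -1 * (\sum_p z 0 p * (w p).2 i x) = 0.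
  by move=> xst; exact: (sol_eq0 st K0 VM small lK sd ds dt i xst).2.
transitivity (neumann_data (fun i x => \sum_p z 0 p * (w p).2 i x)).
  have u1E i x : s <= x <= t -> u1 i x = \sum_p z 0 p * (w p).2 i x.
    by move=> xst; have /eqP := H i x xst; rewrite mulN1r subr_eq0 => /eqP.
  by apply: eq_row_split => i; rewrite !neumann_dataE u1E// lexx ltW.
by rewrite neumann_data_sum mulmx_sum_row; apply: eq_bigr => p _; rewrite rowK.
Qed.

(** The pairing of Neumann and Dirichlet data is the boundary term of an
    integration by parts. *)
Lemma dirichlet_neumann_form u1 v :
  (neumann_data u1 *m (dirichlet_data v)^T) 0 0 =
  \sum_i u1 i t * v i t - \sum_i u1 i s * v i s.
Proof.
rewrite mxE big_split_ord/= addrC; congr (_ + _); rewrite -?sumrN;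
by apply: eq_bigr => i _; rewrite [_^T _ _]mxE neumann_dataE dirichlet_dataE ?mulNr.
Qed.

(** For two energies, Lagrange's identity expresses the difference of the matrices
    by the integral of (m - l) u . v. *)
Lemma dtn_lagrange l m E E' u u1 v v1 : dtn_matrix l E -> dtn_matrix m E' ->
  sch_sol s t V l u u1 -> sch_sol s t V m v v1 ->
  \sum_i (u1 i t * v i t - u i t * v1 i t) - \sum_i (u1 i s * v i s - u i s * v1 i s) =
  (dirichlet_data u *m (E - E'^T) *m (dirichlet_data v)^T) 0 0.
Proof.
move=> HE HE' su sv; rewrite mulmxBr mulmxBl -(HE _ _ su).
have -> : dirichlet_data u *m E'^T *m (dirichlet_data v)^T =
    (neumann_data v1 *m (dirichlet_data u)^T)^T.
  by rewrite (HE' _ _ sv) !trmx_mul trmxK mulmxA.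
rewrite [RHS]mxE [X in _ = _ + X]mxE [X in _ = _ - X]mxE !dirichlet_neumann_form.
have tr x : \sum_i u i x * v1 i x = \sum_i v1 i x * u i x.
  by apply: eq_bigr => i _; rewrite mulrC.
by rewrite !sumrB !tr; ring.
Qed.

(** By Lagrange's identity at equal energies. *)
Lemma dtn_sym l E : n%:R * M + `|l| <= K -> dtn_matrix l E -> E^T = E.
Proof.
move=> lK HE; apply/matrixP => p q.
have [u [u1 [su ud]]] := dirichlet_data_exists (delta_mx 0 p) lK.
have [v [v1 [sv vd]]] := dirichlet_data_exists (delta_mx 0 q) lK.
have := dtn_lagrange HE HE su sv; rewrite ud vd.
have pg := lagrange_identity Vsym su sv.
have st1 : s <= s <= t by rewrite lexx ltW.
have st2 : s <= t <= t by rewrite lexx ltW.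
have := prim_dist_le (M := 0) pg _ st1 st2 => /(_ _)/wrap[].
  by apply: ae_on_all => x _; rewrite subrr mul0r normr0.
rewrite mul0r normr_le0 => /eqP -> /esym.
by rewrite -rowE trmx_delta -colE !mxE => /eqP; rewrite subr_eq0 => /eqP ->.
Qed.

Let data_le u S : (forall p, `|dirichlet_data u 0 p| <= S) ->
  forall i, `|u i s| + `|u i t| <= 2 * S.
Proof.
move=> uS i; have := uS (lshift n i); have := uS (rshift n i).
by rewrite !dirichlet_dataE; lra.
Qed.

(** The solutions in [dtn_lagrange] are bounded by 4 when their boundary data are
    standard basis vectors. *)
Lemma dtn_lipschitz l m E E' : n%:R * M + `|l| <= K -> n%:R * M + `|m| <= K ->
  dtn_matrix l E -> dtn_matrix m E' ->
  forall p q, `|E p q - E' p q| <= 16 * n%:R * (t - s) * `|m - l|.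
Proof.
move=> lK mK HE HE' p q.
have [u [u1 [su ud]]] := dirichlet_data_exists (delta_mx 0 p) lK.
have [v [v1 [sv vd]]] := dirichlet_data_exists (delta_mx 0 q) mK.
have := dtn_lagrange HE HE' su sv; rewrite ud vd (dtn_sym mK HE').
rewrite -rowE trmx_delta -colE !mxE => <-.
have pg := lagrange_identity Vsym su sv.
have st1 : s <= s <= t by rewrite lexx ltW.
have st2 : s <= t <= t by rewrite lexx ltW.
have := prim_dist_le (M := `|m - l| * (16 * n%:R)) pg _ st1 st2 => /(_ _)/wrap[]; last first.
  move=> /le_trans; apply; rewrite (gtr0_norm (_ : 0 < t - s)) ?subr_gt0//.
  by rewrite le_eqVlt; apply/orP; left; apply/eqP; ring.
have d1 r k : `|(delta_mx 0 r : 'rV[R]_(n + n)) 0 k| <= 1.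
  by rewrite mxE; case: (_ && _); rewrite ?normr1 ?normr0.
apply: ae_on_all => x xst; rewrite normrM ler_wpM2l//.
apply: le_trans (ler_norm_sum _ _ _) _; rewrite mulrC mulr_natl -[n in _ *+ n]card_ord -sumr_const.
apply: ler_sum => i _; rewrite normrM (_ : 16 = 4 * 4 :> R); last by rewrite -natrM.
have uu := sol_bound st K0 VM small lK su (data_le (S := 1) _) i xst.
have vv := sol_bound st K0 VM small mK sv (data_le (S := 1) _) i xst.
rewrite ler_pM//.
  by apply: le_trans (uu _) _; [rewrite ud|lra].
by apply: le_trans (vv _) _; [rewrite vd|lra].
Qed.

(** Both solutions with data [z] are close to the same affine function, hence the
    integral of u . v in [dtn_lagrange] is positive. In numbers, the square of the
    affine function integrates to at least (t - s) |z|^2 / 6, and the errors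
    contribute at most half of this. *)
Lemma dtn_decreasing l m E E' (z : 'rV[R]_(n + n)) :
  n%:R * M + `|l| <= K -> n%:R * M + `|m| <= K ->
  dtn_matrix l E -> dtn_matrix m E' -> l < m -> z != 0 ->
  0 < (z *m (E - E') *m z^T) 0 0.
Proof.
move=> lK mK HE HE' lm z0.
have [u [u1 [su ud]]] := dirichlet_data_exists z lK.
have [v [v1 [sv vd]]] := dirichlet_data_exists z mK.
have := dtn_lagrange HE HE' su sv; rewrite ud vd (dtn_sym mK HE') => <-.
have pg := lagrange_identity Vsym su sv.
pose S := \sum_p `|z 0 p|.
pose Z := \sum_p z 0 p ^+ 2.
have Z0 : 0 < Z.
  rewrite lt_neqAle sumr_ge0 ?andbT; last by move=> p _; exact: sqr_ge0.
  apply: contra z0 => /eqP/esym Z0; apply/eqP/rowP => p; rewrite mxE.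
  by apply/eqP; rewrite -sqrf_eq0; apply/eqP; apply: (psumr_eq0P _ Z0) => // ? _; exact: sqr_ge0.
have S0 : 0 <= S by apply: sumr_ge0.
have SZ : S ^+ 2 <= 2 * n%:R * Z.
  have -> : Z = \sum_p `|z 0 p| ^+ 2 by apply: eq_bigr => p _; rewrite real_normK ?num_real.
  by have := sqr_sum_le (fun p => `|z 0 p|); rewrite card_ord natrD -mulr2n mulr_natl.
pose al i x := affine_itv s t (z 0 (lshift n i)) (z 0 (rshift n i)) x.
pose a i : R := `|z 0 (lshift n i)| + `|z 0 (rshift n i)|.
have aS : \sum_i a i = S by rewrite big_split/= /S big_split_ord.
have a_le i : a i <= S.
  by rewrite -aS (bigD1 i)//= lerDl sumr_ge0// => j _; rewrite addr_ge0.
have uz i : (u i s = z 0 (lshift n i)) * (u i t = z 0 (rshift n i)).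
  by rewrite -ud !dirichlet_dataE.
have vz i : (v i s = z 0 (lshift n i)) * (v i t = z 0 (rshift n i)).
  by rewrite -vd !dirichlet_dataE.
have uS i : `|u i s| + `|u i t| <= S by rewrite !uz; exact: a_le.
have vS i : `|v i s| + `|v i t| <= S by rewrite !vz; exact: a_le.
pose ep := 2 * (K * (t - s) ^+ 2).
have ep0 : 0 <= ep by rewrite mulr_ge0// mulr_ge0// sqr_ge0.
have ep_small : 72 * n%:R * ep + 72 * ep <= 1.
  by have := small; rewrite -natr1 /ep; lra.
have ua i x (xst : s <= x <= t) : `|u i x - al i x| <= ep * S.
  by have := sol_affine st K0 VM small lK su uS i xst; rewrite !uz.
have va i x (xst : s <= x <= t) : `|v i x - al i x| <= ep * S.
  by have := sol_affine st K0 VM small mK sv vS i xst; rewrite !vz.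
have /choice[F HF] : forall i, exists F, prim s t F (fun x => al i x ^+ 2) /\
    F t - F s >= (t - s) / 6 * (z 0 (lshift n i) ^+ 2 + z 0 (rshift n i) ^+ 2).
  move=> i; have [F pF FE] := prim_affine_sqr (z 0 (lshift n i)) (z 0 (rshift n i)) st.
  exists F; split => //; rewrite FE.
  have -> : (t - s) / 3 = (t - s) / 6 * 2 by field.
  rewrite -[X in _ <= X]mulrA ler_wpM2l// ?divr_ge0 ?subr_ge0 ?(ltW st)//.
  by have := sqr_ge0 (z 0 (lshift n i) + z 0 (rshift n i)); rewrite sqrrD; lra.
have pF := primZ (m - l) (primB (prim_sum (index_enum 'I_n) (fun i => (HF i).1))
  (primZ (3 * ep * S ^+ 2) (prim_id s t))).
have := prim_le (ltW st) pF pg _ => /(_ _)/wrap[]; last first.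
  move=> H; apply: lt_le_trans H; rewrite -mulrBr mulr_gt0 ?subr_gt0//= -subr_gt0.
  have -> : \sum_i F i t - 3 * ep * S ^+ 2 * t - (\sum_i F i s - 3 * ep * S ^+ 2 * s) =
     \sum_i (F i t - F i s) - (t - s) * (3 * ep * S ^+ 2) by rewrite sumrB; ring.
  have : (t - s) / 6 * Z <= \sum_i (F i t - F i s).
    rewrite /Z big_split_ord/= -big_split/= mulr_sumr; apply: ler_sum => i _; exact: (HF i).2.
  suff : 0 < (t - s) * (Z / 6 - 3 * ep * S ^+ 2) by lra.
  rewrite mulr_gt0 ?subr_gt0//.
  have : 3 * ep * S ^+ 2 <= 3 * ep * (2 * n%:R * Z) by rewrite ler_wpM2l// mulr_ge0.
  have : 72 * n%:R * ep * Z <= 1 * Z by rewrite ler_wpM2r ?(ltW Z0)//; lra.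
  lra.
apply: ae_on_all => x xst; rewrite ler_wpM2l ?subr_ge0 ?(ltW lm)//= mulr1.
have step i : al i x ^+ 2 - (2 * a i * (ep * S) + (ep * S) ^+ 2) <= u i x * v i x.
  have := affine_itv_le (z 0 (lshift n i)) (z 0 (rshift n i)) xst.
  rewrite -/(a i) -/(al i x); have := ua i x xst; have := va i x xst.
  move: (u i x) (v i x) (al i x) => U W A H1 H2 H3.
  have e0 : 0 <= ep * S by apply: le_trans H1.
  have -> : U * W = A ^+ 2 + A * (U - A) + A * (W - A) + (U - A) * (W - A) by ring.
  have n1 : `|A * (U - A)| <= a i * (ep * S) by rewrite normrM ler_pM.
  have n2 : `|A * (W - A)| <= a i * (ep * S) by rewrite normrM ler_pM.
  have n3 : `|(U - A) * (W - A)| <= (ep * S) * (ep * S) by rewrite normrM ler_pM.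
  move: n1 n2 n3; rewrite !ler_norml => /andP[n1 _] /andP[n2 _] /andP[n3 _].
  by rewrite expr2; lra.
apply: le_trans (ler_sum _ (fun i _ => step i)).
rewrite sumrB lerD2l lerN2 big_split/= -mulr_suml -mulr_sumr aS sumr_const card_ord.
rewrite -mulr_natl.
have : n%:R * ep * (ep * S ^+ 2) <= 1 * (ep * S ^+ 2).
  by rewrite ler_wpM2r ?mulr_ge0 ?sqr_ge0//; lra.
rewrite expr2; lra.
Qed.

(** The form is the integral of the energy density, which is nonnegative when
    V - l is. *)
Lemma dtn_ge0 l E (z : 'rV[R]_(n + n)) : n%:R * M + `|l| <= K -> dtn_matrix l E ->
  l <= - (n%:R * M) -> 0 <= (z *m E *m z^T) 0 0.
Proof.
move=> lK HE lM; have [u [u1 [su ud]]] := dirichlet_data_exists z lK.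
rewrite -ud -(HE _ _ su) dirichlet_neumann_form.
have := prim_le (ltW st) (prim_cst s t 0) (energy_identity su) _ => /(_ _)/wrap[].
  apply: ae_on_imp VM _ => x _ Vx; rewrite big_split/= addr_ge0//.
    by apply: sumr_ge0 => i _; exact: sqr_ge0.
  rewrite /sch_rhs; under eq_bigr do rewrite mulrBl -mulrA -expr2.
  rewrite sumrB -mulr_sumr.
  have H : `|\sum_i (\sum_k V x i k * u k x) * u i x| <= n%:R * M * \sum_i u i x ^+ 2.
    apply: le_trans (_ : M * (\sum_i `|u i x|) ^+ 2 <= _); last first.
      rewrite [n%:R * M]mulrC -mulrA ler_wpM2l//.
      have := sqr_sum_le (fun i => `|u i x|); rewrite card_ord => /le_trans; apply.
      by rewrite ler_wpM2l// ler_sum// => i _; rewrite real_normK ?num_real.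
    rewrite expr2 mulr_suml mulr_sumr; apply: le_trans (ler_norm_sum _ _ _) _.
    apply: ler_sum => i _; rewrite normrM mulrCA [X in _ <= X]mulrC ler_wpM2r//.
    apply: le_trans (ler_norm_sum _ _ _) _; rewrite mulr_sumr.
    by apply: ler_sum => k _; rewrite normrM ler_wpM2r.
  have U0 : 0 <= \sum_i u i x ^+ 2 by apply: sumr_ge0 => i _; exact: sqr_ge0.
  have : l * (\sum_i u i x ^+ 2) <= - (n%:R * M) * (\sum_i u i x ^+ 2) by rewrite ler_wpM2r.
  by move: H; rewrite ler_norml => /andP[]; lra.
by lra.
Qed.

End DirichletToNeumann.

(** * The Morse index of a Hermitian matrix *)

Section HermitianIndex.
Variables (C : numClosedFieldType) (N : nat).
Implicit Types (c e : C) (A B : 'M[C]_N) (x : 'rV[C]_N) (S : {set 'I_N}).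

Definition qform A x : C := (x *m A *m x^t*) 0 0.

Definition sqnorm x : C := \sum_i `|x 0 i| ^+ 2.

Lemma sqnorm_ge0 x : 0 <= sqnorm x.
Proof. by apply: sumr_ge0 => i _; rewrite exprn_ge0. Qed.

Lemma sqnorm_gt0 x : x != 0 -> 0 < sqnorm x.
Proof.
move=> x0; rewrite lt_neqAle sqnorm_ge0 andbT; apply: contra x0 => /eqP/esym H.
apply/eqP/rowP => i; rewrite mxE; apply/eqP; rewrite -normr_eq0 -sqrf_eq0.
by apply/eqP; apply: (psumr_eq0P _ H) => // j _; rewrite exprn_ge0.
Qed.

Lemma sqnormE x : sqnorm x = (x *m x^t*) 0 0.
Proof. by rewrite mxE; apply: eq_bigr => i _; rewrite !mxE normCK. Qed.

Lemma qformB A B x : qform (A - B) x = qform A x - qform B x.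
Proof. by rewrite /qform mulmxBr mulmxBl [LHS]mxE [X in _ + X]mxE. Qed.

Lemma qform_bound A c x : (forall p q, `|A p q| <= c) ->
  `|qform A x| <= N%:R ^+ 2 * c * sqnorm x.
Proof.
move=> Ac; rewrite /qform mxE; apply: le_trans (ler_norm_sum _ _ _) _.
have xs p : `|x 0 p| <= sqrtC (sqnorm x).
  rewrite -(@ler_pXn2r _ 2) ?nnegrE ?sqrtC_ge0 ?sqnorm_ge0// sqrtCK.
  by rewrite /sqnorm (bigD1 p)//= lerDl sumr_ge0// => i _; rewrite exprn_ge0.
apply: le_trans (_ : \sum_(q < N) \sum_(p < N) c * sqnorm x <= _); last first.
  by rewrite !sumr_const card_ord -mulrnA -[c * _ *+ _]mulr_natl natrM -expr2 mulrA.
apply: ler_sum => q _; rewrite mxE mulr_suml; apply: le_trans (ler_norm_sum _ _ _) _.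
apply: ler_sum => p _; rewrite !mxE !normrM norm_conjC mulrAC [X in X <= _]mulrC ler_pM ?mulr_ge0//.
by rewrite -[X in _ <= X]sqrtCK expr2 ler_pM.
Qed.

(** [X] lists the vectors of an orthonormal eigenbasis with indices in [S], and [w]
    the coordinates of [x]. *)
Lemma spectral_subspace A S : A \is hermsymmx -> exists X : 'M[C]_(#|S|, N),
  [/\ \rank X = #|S|,
    X *m A = diag_mx (\row_i spectral_diag A 0 (enum_val i)) *m X &
    forall x, (x <= X)%MS -> exists w : 'I_#|S| -> C,
      qform A x = \sum_i spectral_diag A 0 (enum_val i) * `|w i| ^+ 2 /\
      sqnorm x = \sum_i `|w i| ^+ 2].
Proof.
move=> hA; have /hermitian_normalmx/orthomx_spectralP AE := hA.
pose P := spectralmx A; have PU : P \is unitarymx by exact: spectral_unitarymx.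
pose X := \matrix_(i < #|S|) row (enum_val i) P.
have XU : X *m X^t* = 1%:M.
  apply/matrixP => i j; have /unitarymxP/matrixP/(_ (enum_val i) (enum_val j)) := PU.
  rewrite !mxE (inj_eq enum_val_inj) => <-.
  by apply: eq_bigr => k _; rewrite !mxE.
have PA : P *m A = diag_mx (spectral_diag A) *m P.
  by rewrite {1}AE -/P !mulmxA mulmxV ?mul1mx// unitarymx_unit.
have XA : X *m A = diag_mx (\row_i spectral_diag A 0 (enum_val i)) *m X.
  apply/row_matrixP => i; rewrite row_mul rowK -row_mul PA.
  by apply/rowP => j; rewrite [LHS]mxE !mul_diag_mx !mxE.
exists X; split => //; first by apply: mxrank_unitary; apply/unitarymxP.
move=> x /submxP[w ->]; exists (w 0); split; last first.
  rewrite sqnormE trmx_mul map_mxM -!mulmxA [X *m _]mulmxA XU mul1mx mxE.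
  by apply: eq_bigr => i _; rewrite !mxE normCK.
rewrite /qform trmx_mul map_mxM -(mulmxA w) XA -!mulmxA [X *m _]mulmxA XU mul1mx mulmxA mxE.
by apply: eq_bigr => i _; rewrite mul_mx_diag !mxE normCK mulrAC mulrC.
Qed.

Definition morse_index A : nat := #|[set p | spectral_diag A 0 p < 0]%SET|.

Lemma spectral_diag_real A p : A \is hermsymmx -> spectral_diag A 0 p \is Num.real.
Proof. by move=> /hermitian_spectral_diag_real/mxOverP; apply. Qed.

(** The witness is below each nonzero |D p| as its inverse is above each |D p|^-1. *)
Lemma spectral_gap A : exists2 e : C, 0 < e &
  forall p, spectral_diag A 0 p != 0 -> e <= `|spectral_diag A 0 p|.
Proof.
pose s := 1 + \sum_p `|spectral_diag A 0 p|^-1.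
have s0 : 0 < s by rewrite ltr_wpDr// sumr_ge0// => p _; rewrite invr_ge0.
exists s^-1; first by rewrite invr_gt0.
move=> p Dp; rewrite -[X in _ <= X]invrK lef_pV2 ?posrE ?invr_gt0 ?normr_gt0//.
by rewrite /s (bigD1 p)//= addrCA lerDl addr_ge0// sumr_ge0// => q _; rewrite invr_ge0.
Qed.

Lemma hermitian_kernel A x y : A \is hermsymmx -> y *m A = 0 ->
  qform A (x + y) = qform A x.
Proof.
move=> /is_hermitianmxP; rewrite expr0 scale1r => AE yA.
have Ay : A *m y^t* = 0 by rewrite AE -map_mxM -trmx_mul yA trmx0 map_mx0.
by rewrite /qform mulmxDl yA addr0 linearD/= map_mxD mulmxDr -!(mulmxA x) Ay mulmx0 addr0.
Qed.

Lemma negative_subspace A : A \is hermsymmx -> exists2 e : C, 0 < e &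
  exists2 X : 'M[C]_(morse_index A, N), \rank X = morse_index A &
    forall x, (x <= X)%MS -> qform A x <= - e * sqnorm x.
Proof.
move=> hA; have [e e0 He] := spectral_gap A; exists e => //.
have [X [rX _ HX]] := spectral_subspace [set p | spectral_diag A 0 p < 0]%SET hA.
exists X => // x /HX[w [-> ->]]; rewrite mulr_sumr; apply: ler_sum => i _.
have := enum_valP i; rewrite inE => Di; rewrite ler_wpM2r ?exprn_ge0//.
by rewrite -lerN2 opprK -ltr0_norm// He// lt_eqF.
Qed.

Lemma nonnegative_subspace A : A \is hermsymmx ->
  exists2 d, (d + morse_index A = N)%N & exists2 X : 'M[C]_(d, N), \rank X = d &
    forall x, (x <= X)%MS -> 0 <= qform A x.
Proof.
move=> hA; pose S := [set p | spectral_diag A 0 p < 0]%SET.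
exists #|~: S|; first by rewrite addnC cardsC card_ord.
have [X [rX _ HX]] := spectral_subspace (~: S) hA.
exists X => // x /HX[w [-> _]]; apply: sumr_ge0 => i _.
have := enum_valP i; rewrite !inE => Di; rewrite mulr_ge0 ?exprn_ge0//.
by rewrite real_leNgt ?real0 ?spectral_diag_real.
Qed.

Lemma positive_subspace A : A \is hermsymmx -> exists2 e : C, 0 < e &
  exists2 d, (N <= d + morse_index A + \rank (kermx A))%N &
  exists2 X : 'M[C]_(d, N), \rank X = d &
    forall x, (x <= X)%MS -> e * sqnorm x <= qform A x.
Proof.
move=> hA; have [e e0 He] := spectral_gap A; exists e => //.
pose S := [set p | spectral_diag A 0 p < 0]%SET; pose Z := [set p | spectral_diag A 0 p == 0]%SET.
exists #|~: (S :|: Z)|.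
  have [Y [rY YA _]] := spectral_subspace Z hA.
  have YK : (Y <= kermx A)%MS.
    rewrite sub_kermx YA; apply/eqP/matrixP => i j; rewrite mul_diag_mx !mxE.
    by have := enum_valP i; rewrite inE => /eqP ->; rewrite mul0r.
  have := mxrankS YK; rewrite rY => H.
  rewrite -[in X in (X <= _)%N](card_ord N) -(cardsC (S :|: Z)) -addnA addnC leq_add2l.
  by apply: leq_trans (leq_card_setU S Z) _; rewrite leq_add2l.
have [X [rX _ HX]] := spectral_subspace (~: (S :|: Z)) hA.
exists X => // x /HX[w [-> ->]]; rewrite mulr_sumr; apply: ler_sum => i _.
have := enum_valP i; rewrite !inE negb_or => /andP[Di Di0]; rewrite ler_wpM2r ?exprn_ge0//.
rewrite -real_leNgt ?real0 ?spectral_diag_real// in Di.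
by rewrite -(ger0_norm Di) He.
Qed.

Lemma rank_disjoint_le d1 d2 (U : 'M[C]_(d1, N)) (W : 'M[C]_(d2, N)) :
  (forall x, (x <= U)%MS -> (x <= W)%MS -> x = 0) -> (\rank U + \rank W <= N)%N.
Proof.
move=> UW; rewrite -mxrank_sum_cap.
have -> : \rank (U :&: W)%MS = 0%N.
  apply/eqP; rewrite mxrank_eq0; apply/eqP/row_matrixP => i; rewrite row0.
  have := row_sub i (U :&: W)%MS; rewrite sub_capmx => /andP[]; exact: UW.
by rewrite addn0 rank_leq_col.
Qed.

(** The index is the largest dimension on which the form is negative definite,
    and the smallest codimension on which it is nonnegative. *)
Lemma morse_index_ge B d (U : 'M[C]_(d, N)) : B \is hermsymmx ->
  (forall x, (x <= U)%MS -> x != 0 -> qform B x < 0) -> (\rank U <= morse_index B)%N.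
Proof.
move=> hB HU; have [d' dN [W rW HW]] := nonnegative_subspace hB.
suff : (\rank U + \rank W <= N)%N by rewrite rW -[X in (_ <= X)%N]dN addnC leq_add2l.
apply: rank_disjoint_le => x xU xW; apply/eqP; apply/negP => /negP x0.
by have := le_lt_trans (HW _ xW) (HU _ xU x0); rewrite ltxx.
Qed.

Lemma morse_index_le B d (U : 'M[C]_(d, N)) : B \is hermsymmx ->
  (forall x, (x <= U)%MS -> 0 <= qform B x) -> (\rank U + morse_index B <= N)%N.
Proof.
move=> hB HU; have [e e0 [W rW HW]] := negative_subspace hB.
rewrite -rW; apply: rank_disjoint_le => x xU xW; apply/eqP; apply/negP => /negP x0.
have := le_trans (HU _ xU) (HW _ xW); rewrite mulNr oppr_ge0 => H.
by have := lt_le_trans (mulr_gt0 e0 (sqnorm_gt0 x0)) H; rewrite ltxx.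
Qed.

(** [B] is negative definite on the sum of the negative subspace and the kernel
    of [A]. *)
Lemma morse_index_lt A B : A \is hermsymmx -> B \is hermsymmx ->
  (forall x, x != 0 -> qform B x < qform A x) ->
  (morse_index A + \rank (kermx A) <= morse_index B)%N.
Proof.
move=> hA hB BA; have [e e0 [X rX HX]] := negative_subspace hA.
have XK : (X :&: kermx A)%MS = 0.
  apply/row_matrixP => i; rewrite row0; set x := row _ _.
  have := row_sub i (X :&: kermx A)%MS; rewrite sub_capmx => /andP[xX /sub_kermxP xK].
  apply/eqP; apply/negP => /negP x0; have := HX _ xX.
  rewrite /qform -/x xK mul0mx mxE mulNr oppr_ge0 => H.
  by have := lt_le_trans (mulr_gt0 e0 (sqnorm_gt0 x0)) H; rewrite ltxx.
have <- : \rank (X + kermx A)%MS = (morse_index A + \rank (kermx A))%N.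
  by rewrite -[in RHS]rX -mxrank_sum_cap XK mxrank0 addn0.
apply: morse_index_ge => // x /sub_addsmxP[[y z] /= xE] x0.
apply: lt_le_trans (BA _ x0) _; rewrite xE hermitian_kernel//; last first.
  by rewrite -mulmxA mulmx_ker mulmx0.
apply: le_trans (HX _ _) _; first exact: submxMl.
by rewrite mulNr oppr_le0 mulr_ge0 ?sqnorm_ge0 ?ltW.
Qed.

(** Small perturbations keep the negative and positive subspaces definite, so only
    the kernel can change sign. *)
Lemma morse_index_near A : A \is hermsymmx -> exists2 e : C, 0 < e &
  forall B, B \is hermsymmx -> (forall p q, `|(B - A) p q| <= e) ->
    (morse_index A <= morse_index B <= morse_index A + \rank (kermx A))%N.
Proof.
move=> hA; have [e1 e10 [X rX HX]] := negative_subspace hA.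
have [e2 e20 [d dN [Y rY HY]]] := positive_subspace hA.
pose k : C := N.+1%:R ^+ 2 * (e1^-1 + e2^-1) * 2.
have ee : 0 < e1^-1 + e2^-1 by rewrite addr_gt0 ?invr_gt0.
have k0 : 0 < k by rewrite !mulr_gt0// exprn_gt0.
have ke (e' : C) : 0 < e' -> e'^-1 <= e1^-1 + e2^-1 -> N%:R ^+ 2 * k^-1 <= e' / 2.
  move=> e'0 He'; rewrite ler_pdivrMr//.
  have -> : e' / 2 * k = N.+1%:R ^+ 2 * (e' * (e1^-1 + e2^-1)).
    by rewrite /k; move: (e1^-1 + e2^-1) => g; field.
  apply: le_trans (_ : N.+1%:R ^+ 2 <= _); first by rewrite lerXn2r ?nnegrE// ler_nat.
  by rewrite ler_peMr ?exprn_ge0// -ler_pdivrMl// mulr1.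
exists k^-1; first by rewrite invr_gt0.
move=> B hB BA.
have close (e' : C) x : 0 < e' -> e'^-1 <= e1^-1 + e2^-1 ->
    `|qform B x - qform A x| <= e' / 2 * sqnorm x.
  move=> e'0 He'; rewrite -qformB; apply: le_trans (qform_bound x BA) _.
  by rewrite ler_wpM2r ?sqnorm_ge0// ke.
have qreal D x : D \is hermsymmx -> qform D x \is Num.real.
  move/is_hermitianmxP; rewrite expr0 scale1r => DE; apply/CrealP.
  have H (Q : 'M[C]_1) : Q^t* = Q -> (Q 0 0)^* = Q 0 0 by move=> QE; rewrite -[in RHS]QE !mxE.
  by apply: H; rewrite !trmx_mul !map_mxM mulmxA trmxCK -DE.
apply/andP; split.
  rewrite -rX; apply: morse_index_ge => // x xX x0.
  have := close e1 x e10; rewrite lerDl invr_ge0 ltW// => /(_ isT).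
  rewrite real_ler_norml ?realB ?qreal// => /andP[_]; rewrite lerBlDr => /le_lt_trans; apply.
  apply: le_lt_trans (_ : e1 / 2 * sqnorm x + - e1 * sqnorm x < 0); first by rewrite lerD2l HX.
  rewrite -mulrDl {2}(splitr e1) opprD addrA subrr sub0r mulNr oppr_lt0 mulr_gt0//.
    by rewrite divr_gt0.
  exact: sqnorm_gt0.
have : (\rank Y + morse_index B <= N)%N.
  apply: morse_index_le => // x xY.
  have := close e2 x e20; rewrite lerDr invr_ge0 ltW// => /(_ isT).
  rewrite real_ler_norml ?realB ?qreal// => /andP[+ _]; rewrite lerBrDl => /(le_trans _); apply.
  apply: le_trans (_ : e2 * sqnorm x - e2 / 2 * sqnorm x <= _); last by rewrite lerD2r HY.
  rewrite -mulrBl {1}(splitr e2) addrK mulr_ge0 ?sqnorm_ge0//.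
  by rewrite divr_ge0 ?ltW.
by rewrite rY => H; move: (leq_trans H dN); rewrite -addnA leq_add2l.
Qed.

Lemma morse_index_eq0 A : A \is hermsymmx -> (forall x, 0 <= qform A x) -> morse_index A = 0%N.
Proof.
move=> hA A0; have := morse_index_le (U := 1%:M) hA (fun x _ => A0 x).
by rewrite mxrank1 -[X in (_ <= X)%N]addn0 leq_add2l leqn0 => /eqP.
Qed.

(** Intersecting a negative subspace of [A] with [W] costs at most the codimension
    of [W]. *)
Lemma morse_index_codim A B d (W : 'M[C]_(d, N)) : A \is hermsymmx -> B \is hermsymmx ->
  (forall x, (x <= W)%MS -> qform A x = qform B x) ->
  (morse_index A + \rank W <= morse_index B + N)%N.
Proof.
move=> hA hB AB; have [e e0 [X rX HX]] := negative_subspace hA.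
rewrite -[in X in (X <= _)%N]rX -mxrank_sum_cap addnC leq_add ?rank_leq_col//.
apply: morse_index_ge => // x; rewrite sub_capmx => /andP[xX xW] x0.
rewrite -AB//; apply: le_lt_trans (HX _ xX) _.
by rewrite mulNr oppr_lt0 mulr_gt0 ?sqnorm_gt0.
Qed.

End HermitianIndex.

(** * Counting the jumps of an integer valued function *)

Section CountingJumps.
Variable R : realType.
Implicit Types (l m r : R).

Lemma esum_split_lt (a : R -> \bar R) l m : (forall x, (0 <= a x)%E) -> l <= m ->
  (\esum_(x in [set x | (x < m)%R]) a x = \esum_(x in [set x | (x < l)%R]) a x
     + \esum_(x in [set x | (l <= x < m)%R]) a x)%E.
Proof.
move=> a0 lm; rewrite (esumID [set x | x < l])//; congr (_ + _)%E.
  congr (esum _ _); apply/seteqP; split => x /=; first by case.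
  by move=> xl; split => //; exact: lt_le_trans lm.
congr (esum _ _); apply/seteqP; split => x /=.
  by move=> [xm /negP]; rewrite -leNgt => lx; rewrite lx.
by move=> /andP[lx xm]; split => //; apply/negP; rewrite -leNgt.
Qed.

(** The hypotheses on the nondecreasing function [f] say that it is continuous from
    the left and jumps by [k l] at [l]. The proof is by induction on the value [f r]:
    it peels off the last jump before [r], located at the supremum of the points
    where [f] is below [f r]. *)
Lemma esum_jumps (f k : R -> nat) l0 r :
  (forall l, l < l0 -> k l = 0%N) -> f l0 = 0%N ->
  (forall l m, l0 <= l -> l < m -> m <= r -> (f l + k l <= f m)%N) ->
  (forall l, l0 <= l -> l <= r -> exists2 d, 0 < d &
    forall m, l0 <= m -> m <= r -> `|m - l| < d -> (f l <= f m <= f l + k l)%N) ->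
  l0 <= r ->
  (\esum_(l in [set l | (l < r)%R]) (k l)%:R%:E = (f r)%:R%:E :> \bar R)%E.
Proof.
move=> k0 f0 mono near l0r.
have [N fN] := ubnP (f r); move: fN => {}fN.
suff H : forall r', l0 <= r' -> r' <= r -> (f r' < N)%N ->
    (\esum_(l in [set l | (l < r')%R]) (k l)%:R%:E = (f r')%:R%:E :> \bar R)%E by exact: H.
elim: N {fN} => [//|N IH] r' l0r' r'r; rewrite ltnS => fN.
have k_ge0 x : (0 <= (k x)%:R%:E :> \bar R)%E by rewrite lee_fin ler0n.
have [f0'|f_gt0] := posnP (f r').
  rewrite f0'; apply: esum1 => l /= lr'.
  have [ll0|l0l] := ltP l l0; first by rewrite k0.
  have := mono l r' l0l lr' r'r.
  by rewrite f0' leqn0 addn_eq0 => /andP[_ /eqP ->].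
pose A := [set l | l0 <= l <= r' /\ (f l < f r')%N].
have Al0 : A l0 by split; rewrite ?lexx ?f0.
have supA : has_sup A by split; [exists l0|exists r' => l [/andP[]]].
pose c := sup A.
have l0c : l0 <= c by apply: ub_le_sup => //; exact: supA.2.
have cr' : c <= r' by apply: ge_sup; [exact: supA.1|move=> l [/andP[]]].
have cr := le_trans cr' r'r.
have [d d0 nearc] := near c l0c cr.
have fc : (f c < f r')%N.
  have [l Al cl] := sup_adherent d0 supA; have [/andP[l0l lr'] fl] := Al.
  have lc : l <= c by apply: ub_le_sup => //; exact: supA.2.
  have /nearc H := l0l; apply: leq_ltn_trans fl.
  have lcd : `|l - c| < d by rewrite ler0_norm ?subr_le0// opprB; rewrite -/c in cl; lra.
  by case/andP: (H (le_trans lr' r'r) lcd).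
have {}cr' : c < r'.
  by rewrite lt_neqAle cr' andbT; apply/eqP => E; rewrite E ltnn in fc.
have fA l : c < l -> l <= r' -> (f r' <= f l)%N.
  move=> cl lr'; rewrite leqNgt; apply/negP => fl.
  have : l <= c by apply: ub_le_sup; [exact: supA.2|split => //; rewrite lr' (le_trans l0c) ?ltW].
  by rewrite leNgt cl.
have jump : (f c + k c = f r')%N.
  apply/eqP; rewrite eqn_leq (mono _ _ l0c cr' r'r)/=.
  pose m := Num.min r' (c + d / 2).
  have cm : c < m by rewrite lt_min cr'/=; lra.
  have mr' : m <= r' by rewrite ge_min lexx.
  apply: leq_trans (fA m cm mr') _.
  have mcd : `|m - c| < d.
    rewrite gtr0_norm ?subr_gt0// ltrBlDl; apply: (@le_lt_trans _ _ (c + d / 2)); last lra.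
    by rewrite ge_min lexx orbT.
  by case/andP: (nearc m (le_trans l0c (ltW cm)) (le_trans mr' r'r) mcd).
rewrite (@esum_split_lt _ c r')//; last exact: ltW.
rewrite (IH c l0c cr (leq_trans fc fN)).
rewrite (esumID [set c])//.
have -> : [set x | (c <= x < r')%R] `&` [set c] = [set c].
  by apply/seteqP; split => x /=; [case|move=> ->; rewrite lexx].
rewrite esum_set1// esum1 ?adde0; first by rewrite -EFinD -natrD jump.
move=> l /= [/andP[cl lr'] /eqP lc].
have {}cl : c < l by rewrite lt_neqAle eq_sym lc.
have := mono l r' (le_trans l0c (ltW cl)) lr' r'r.
have := fA l cl (ltW lr'); move=> H1 H2.
have : (f l + k l <= f l)%N by exact: leq_trans H1.
by rewrite -[X in (_ <= X)%N]addn0 leq_add2l leqn0 => /eqP ->.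
Qed.

End CountingJumps.

(** * The nodal matrix *)

Section NodalMatrix.
Variables (R : realType) (n p : nat).
Local Notation m := p.+1.
Local Notation C := R[i].
Local Notation toC := (map_mx (real_complex R)).
Implicit Types (th : R) (x y : 'rV[C]_(m * n)) (E : 'I_m -> 'M[R]_(n + n)).

Lemma conj_real_complex (c : R) : (real_complex R c)^* = real_complex R c.
Proof. by apply/eqP; rewrite eq_complex/= oppr0 !eqxx. Qed.

Lemma map_conj_toC q1 q2 (D : 'M[R]_(q1, q2)) : map_mx Num.conj (toC D) = toC D.
Proof. by apply/matrixP => i k; rewrite !mxE conj_real_complex. Qed.

Lemma expi_norm th : expi th * (expi th)^* = 1.
Proof.
apply/eqP; rewrite eq_complex/=; apply/andP; split; apply/eqP; last by ring.
by rewrite mulrN opprK -!expr2 cos2Dsin2.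
Qed.

(** Vectors [x] of length m * n list the values at the nodes 0, ..., m - 1, and
    [x *m node_mx th j] is the value at the node [j]. At the node [m] it is dictated
    by the boundary condition. *)
Definition node_mx th (j : nat) : 'M[C]_(m * n, n) :=
  (if (j < m)%N then 1 else expi th) *:
    lin1_mx (row (inord (if (j < m)%N then j else 0%N)) \o vec_mx).

Lemma node_mx_lt th (j : 'I_m) x : x *m node_mx th j = row j (vec_mx x).
Proof. by rewrite /node_mx ltn_ord scale1r mul_rV_lin1/= inord_val. Qed.

Lemma node_mx_last th x : x *m node_mx th m = expi th *: (x *m node_mx th 0).
Proof.
rewrite /node_mx ltnn /= scale1r -scalemxAr.
by [].
Qed.

(** [x *m cell_mx th j] lists the two boundary values on the cell [j]. *)
Definition cell_mx th (j : nat) : 'M[C]_(m * n, n + n) := row_mx (node_mx th j) (node_mx th j.+1).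

(** The matrix of the quadratic form of the operator on functions which solve the
    equation in every cell: the sum of the forms of the Dirichlet-to-Neumann
    matrices of the cells. *)
Definition nodal_mx th E : 'M[C]_(m * n) :=
  \sum_(j < m) cell_mx th j *m toC (E j) *m (cell_mx th j)^t*.

Lemma nodal_form th E x y : x *m nodal_mx th E *m y^t* =
  \sum_(j < m) x *m cell_mx th j *m toC (E j) *m (y *m cell_mx th j)^t*.
Proof.
rewrite mulmx_sumr mulmx_suml; apply: eq_bigr => j _.
by rewrite trmx_mul map_mxM !mulmxA.
Qed.

Lemma qform_nodal th E x : qform (nodal_mx th E) x =
  \sum_(j < m) qform (toC (E j)) (x *m cell_mx th j).
Proof. by rewrite /qform nodal_form summxE. Qed.

Lemma nodal_mxB th E E' : nodal_mx th (fun j => E j - E' j) = nodal_mx th E - nodal_mx th E'.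
Proof.
rewrite /nodal_mx -sumrB; apply: eq_bigr => j _.
by rewrite map_mxB mulmxBr mulmxBl.
Qed.

Lemma nodal_hermitian th E : (forall j, (E j)^T = E j) -> nodal_mx th E \is hermsymmx.
Proof.
move=> symE; apply/is_hermitianmxP; rewrite expr0 scale1r.
rewrite /nodal_mx linear_sum/= -[RHS]/(map_mx _ _) raddf_sum/=; apply: eq_bigr => j _.
rewrite !trmx_mul !map_mxM mulmxA trmxCK.
by rewrite [(toC _)^T]map_trmx symE map_conj_toC.
Qed.

(** A real symmetric matrix separates real and imaginary parts. *)
Lemma toC_form (D : 'M[R]_(n + n)) (z : 'rV[C]_(n + n)) : D^T = D ->
  let re := map_mx (@complex.Re R) z in let im := map_mx (@complex.Im R) z in
  qform (toC D) z = real_complex R ((re *m D *m re^T) 0 0 + (im *m D *m im^T) 0 0).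
Proof.
move=> symD re im.
have zE : z = toC re + 'i *: toC im.
  by apply/rowP => k; rewrite !mxE [LHS]complexE.
have zcE : z^t* = toC re^T - 'i *: toC im^T.
  apply/colP => k; rewrite {1}zE !mxE rmorphD rmorphM /= !conj_real_complex conjCi.
  by rewrite mulNr.
have cross : im *m D *m re^T = (re *m D *m im^T)^T.
  by rewrite !trmx_mul trmxK symD mulmxA.
have cross0 : (im *m D *m re^T) 0 0 = (re *m D *m im^T) 0 0 by rewrite cross mxE.
rewrite /qform {1}zE zcE mulmxDl mulmxBr !mulmxDl -!scalemxAl -!scalemxAr -!map_mxM.
rewrite scalerA -expr2 sqrCi scaleN1r.
move: cross0; set X := re *m D *m re^T; set Y := im *m D *m im^T.
set Z1 := im *m D *m re^T; set Z2 := re *m D *m im^T => cross0.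
clearbody X Y Z1 Z2.
rewrite !mxE cross0 rmorphD /=; ring.
Qed.

Lemma toC_form_gt0 (D : 'M[R]_(n + n)) (z : 'rV[C]_(n + n)) : D^T = D ->
  (forall w : 'rV[R]_(n + n), w != 0 -> 0 < (w *m D *m w^T) 0 0) ->
  z != 0 -> 0 < qform (toC D) z.
Proof.
move=> symD D0 z0; rewrite toC_form// ltcR.
have D0' (w : 'rV[R]_(n + n)) : 0 <= (w *m D *m w^T) 0 0.
  by have [->|/D0/ltW//] := eqVneq w 0; rewrite !mul0mx mxE.
have [re0|re0] := eqVneq (map_mx (@complex.Re R) z) 0; last by rewrite ltr_pwDl ?D0.
rewrite ltr_wpDl// D0//; apply: contra z0 => /eqP im0.
apply/eqP/rowP => k; have /rowP/(_ k) := re0; have /rowP/(_ k) := im0.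
by rewrite !mxE; case: (z 0 k) => u v /= -> ->.
Qed.

Lemma nodal_decreasing th E E' x : (forall j, (E j)^T = E j) -> (forall j, (E' j)^T = E' j) ->
  (forall j (w : 'rV[R]_(n + n)), w != 0 -> 0 < (w *m (E j - E' j) *m w^T) 0 0) ->
  x != 0 -> qform (nodal_mx th E') x < qform (nodal_mx th E) x.
Proof.
move=> symE symE' EE' x0; rewrite -subr_gt0 -qformB -nodal_mxB qform_nodal.
have pos (j : 'I_m) z : z != 0 -> 0 < qform (toC (E j - E' j)) z.
  by apply: toC_form_gt0; [rewrite linearB/= symE symE'|exact: EE'].
have nneg (j : 'I_m) z : 0 <= qform (toC (E j - E' j)) z.
  by have [->|/(pos j)/ltW//] := eqVneq z 0; rewrite /qform !mul0mx mxE.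
have [j xj] : exists j : 'I_m, row j (vec_mx x) != 0.
  apply: contrapT => /forallNP H; move: x0; rewrite -(vec_mxK x) => /eqP; apply.
  have -> : vec_mx x = 0 by apply/row_matrixP => j; rewrite row0; apply/eqP/negPn/negP/H.
  by rewrite linear0.
rewrite (bigD1 j)//= ltr_pwDl ?sumr_ge0// pos//.
rewrite mul_mx_row; apply: contra xj => /eqP; rewrite -row_mx0 => /eq_row_mx[+ _].
by rewrite node_mx_lt => ->.
Qed.

Lemma nodal_ge0 th E x : (forall j, (E j)^T = E j) ->
  (forall j (w : 'rV[R]_(n + n)), 0 <= (w *m E j *m w^T) 0 0) ->
  0 <= qform (nodal_mx th E) x.
Proof.
move=> symE E0; rewrite qform_nodal; apply: sumr_ge0 => j _.
by rewrite toC_form// lecR addr_ge0.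
Qed.

Lemma congruence_bound q1 q2 (J : 'M[C]_(q1, q2)) (D : 'M[C]_q2) (d : C) :
  0 <= d -> (forall i k, `|D i k| <= d) -> forall i k,
  `|(J *m D *m J^t*) i k| <= d * (\sum_i \sum_k `|J i k|) ^+ 2.
Proof.
move=> d0 Dd i k; set T := \sum_i _.
have rowT i' : \sum_k `|J i' k| <= T.
  rewrite /T (bigD1 i')//= lerDl sumr_ge0// => i'' _; exact: sumr_ge0.
have T0 : 0 <= T by apply: le_trans (rowT i); apply: sumr_ge0.
rewrite mxE; apply: le_trans (ler_norm_sum _ _ _) _; rewrite expr2 mulrA.
apply: le_trans (_ : \sum_k' d * T * `|J k k'| <= _); last first.
  by rewrite -mulr_sumr ler_wpM2l// mulr_ge0.
apply: ler_sum => k' _; rewrite normrM [J^t* _ _]mxE [J^T _ _]mxE norm_conjC ler_wpM2r// mxE.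
apply: le_trans (ler_norm_sum _ _ _) _.
apply: le_trans (_ : \sum_k'' d * `|J i k''| <= _); last first.
  by rewrite -mulr_sumr ler_wpM2l.
by apply: ler_sum => k'' _; rewrite normrM mulrC ler_wpM2r.
Qed.

Lemma nodal_close th (e : C) : 0 < e -> exists2 d : R, 0 < d &
  forall E, (forall j q1 q2, `|E j q1 q2| <= d) -> forall q1 q2, `|nodal_mx th E q1 q2| <= e.
Proof.
move=> e0.
pose S : C := 1 + \sum_(j < m) (\sum_q1 \sum_q2 `|cell_mx th j q1 q2|) ^+ 2.
have S0 : 0 < S.
  rewrite ltr_pwDl// sumr_ge0// => j _; rewrite exprn_ge0// sumr_ge0// => q1 _.
  exact: sumr_ge0.
have eS0 : 0 <= e / S by rewrite divr_ge0 ?ltW.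
have /complex_realP[d dE] : e / S \is Num.real by rewrite ger0_real.
have d0 : 0 < d by rewrite -ltcR -dE divr_gt0.
exists d => // E Ed q1 q2; rewrite summxE; apply: le_trans (ler_norm_sum _ _ _) _.
apply: le_trans (_ : \sum_(j < m) e / S * (\sum_q1 \sum_q2 `|cell_mx th j q1 q2|) ^+ 2 <= _);
    last first.
  by rewrite -mulr_sumr -mulrA ler_piMr ?(ltW e0)// mulrC ler_pdivrMr// mul1r /S lerDr.
apply: ler_sum => j _; apply: congruence_bound => // k k'.
by rewrite mxE dE normc_def/= expr0n/= addr0 sqrtr_sqr lecR.
Qed.

(** A vector that vanishes at the node 0 also vanishes at the node m, for all
    boundary conditions. *)
Lemma nodal_theta th th' E x : x *m node_mx 0 0 = 0 ->
  qform (nodal_mx th E) x = qform (nodal_mx th' E) x.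
Proof.
move=> x0; have nodeE t j : (j < m)%N -> node_mx t j = node_mx 0 j.
  by rewrite /node_mx => ->.
rewrite !qform_nodal; apply: eq_bigr => j _; congr qform.
rewrite /cell_mx !mul_mx_row !(nodeE _ j)//; congr row_mx.
have [jm|mj] := ltnP j.+1 m; first by rewrite !(nodeE _ j.+1).
have -> : j.+1 = m by apply/eqP; rewrite eqn_leq mj ltn_ord.
by rewrite !node_mx_last !(nodeE _ 0%N)// x0 !scaler0.
Qed.

End NodalMatrix.

(** * Complex solutions *)

Section ComplexSolutions.
Variables (R : realType) (n : nat) (V : R -> 'M[R]_n).
Local Notation C := R[i].
Local Notation toC := (map_mx (real_complex R)).
Implicit Types (s t w l x : R) (u v : R -> 'cV[C]_n) (c : C).

Definition re_part u (i : 'I_n) (x : R) : R := complex.Re (u x i ord0).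
Definition im_part u (i : 'I_n) (x : R) : R := complex.Im (u x i ord0).

(** The potential is real, so complex solutions are pairs of real ones. *)
Definition csol s t l u u1 :=
  sch_sol s t V l (re_part u) (re_part u1) /\ sch_sol s t V l (im_part u) (im_part u1).

Lemma re_part_comb u v c : re_part (fun x => u x + c *: v x) =
  (fun i x => (re_part u i x + complex.Re c * re_part v i x) + - complex.Im c * im_part v i x).
Proof.
apply/funext => i; apply/funext => x; rewrite /re_part /im_part !mxE.
by case: (u x i ord0) (v x i ord0) (c) => [a b] [d e] [f g] /=; ring.
Qed.

Lemma im_part_comb u v c : im_part (fun x => u x + c *: v x) =
  (fun i x => (im_part u i x + complex.Re c * im_part v i x) + complex.Im c * re_part v i x).
Proof.
apply/funext => i; apply/funext => x; rewrite /re_part /im_part !mxE.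
by case: (u x i ord0) (v x i ord0) (c) => [a b] [d e] [f g] /=; ring.
Qed.

Lemma csol_comb s t l c u u1 v v1 : csol s t l u u1 -> csol s t l v v1 ->
  csol s t l (fun x => u x + c *: v x) (fun x => u1 x + c *: v1 x).
Proof.
move=> [ur ui] [vr vi]; split.
  by rewrite !re_part_comb; apply: sch_sol_comb => //; exact: sch_sol_comb.
by rewrite !im_part_comb; apply: sch_sol_comb => //; exact: sch_sol_comb.
Qed.

Lemma csol0 s t l : csol s t l (fun=> 0) (fun=> 0).
Proof.
by split; have := sch_sol0 V s t l; congr (sch_sol _ _ _ _ _ _); apply/funext => i;
  apply/funext => x; rewrite /re_part /im_part mxE.
Qed.

Lemma csol_sum s t l k (c : 'I_k -> C) (u u1 : 'I_k -> R -> 'cV[C]_n) :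
  (forall j, csol s t l (u j) (u1 j)) ->
  csol s t l (fun x => \sum_j c j *: u j x) (fun x => \sum_j c j *: u1 j x).
Proof.
move=> su; suff : forall r : seq 'I_k, csol s t l (fun x => \sum_(j <- r) c j *: u j x)
    (fun x => \sum_(j <- r) c j *: u1 j x) by apply.
elim=> [|j r IH].
  rewrite (_ : (fun x => \sum_(j <- [::]) c j *: u j x) = fun=> 0); last first.
    by apply/funext => x; rewrite big_nil.
  rewrite (_ : (fun x => \sum_(j <- [::]) c j *: u1 j x) = fun=> 0); last first.
    by apply/funext => x; rewrite big_nil.
  exact: csol0.
have E (v : 'I_k -> R -> 'cV[C]_n) : (fun x => \sum_(i <- j :: r) c i *: v i x) =
    (fun x => \sum_(i <- r) c i *: v i x + c j *: v j x).
  by apply/funext => x; rewrite big_cons; exact: addrC.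
by rewrite !E; exact: csol_comb.
Qed.

Lemma csol_sub s t x y l u u1 : s <= x -> y <= t -> csol s t l u u1 -> csol x y l u u1.
Proof. by move=> sx yt [ur ui]; split; exact: (sch_sol_sub sx yt). Qed.

Lemma sch_sol_glue s t w l (f f1 g g1 : 'I_n -> R -> R) : s <= t -> t <= w ->
  (forall i, f i t = g i t) -> (forall i, f1 i t = g1 i t) ->
  sch_sol s t V l f f1 -> sch_sol t w V l g g1 ->
  sch_sol s w V l (fun i x => if x < t then f i x else g i x)
    (fun i x => if x < t then f1 i x else g1 i x).
Proof.
move=> st tw fg fg1 sf sg i; have [pf pf1] := sf i; have [pg pg1] := sg i; split.
  exact: prim_glue.
apply: prim_ext (prim_glue (fg1 i) st tw pf1 pg1) _; apply: ae_on_all => x _.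
by rewrite /sch_rhs; case: ifP => // _.
Qed.

Lemma csol_glue s t w l u u1 v v1 : s <= t -> t <= w -> u t = v t -> u1 t = v1 t ->
  csol s t l u u1 -> csol t w l v v1 ->
  csol s w l (fun x => if x < t then u x else v x) (fun x => if x < t then u1 x else v1 x).
Proof.
move=> st tw uv uv1 [ur ui] [vr vi].
have reE (f g : R -> 'cV[C]_n) : re_part (fun x => if x < t then f x else g x) =
    (fun i x => if x < t then re_part f i x else re_part g i x).
  by apply/funext => i; apply/funext => x; rewrite /re_part; case: ifP.
have imE (f g : R -> 'cV[C]_n) : im_part (fun x => if x < t then f x else g x) =
    (fun i x => if x < t then im_part f i x else im_part g i x).
  by apply/funext => i; apply/funext => x; rewrite /im_part; case: ifP.
split; rewrite ?reE ?imE; apply: sch_sol_glue => // i;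
  by rewrite /re_part /im_part ?uv ?uv1.
Qed.

Lemma csol_ae_eq0 s t l u u1 : s < t -> csol s t l u u1 -> ae_on s t (fun x => u x = 0) ->
  forall x, s <= x <= t -> u x = 0.
Proof.
move=> st [ur ui] u0 x xst; apply/colP => i; rewrite mxE; apply/eqP; rewrite eq_complex/=.
apply/andP; split; apply/eqP.
  apply: (ae_on_lipschitz_eq0 st (ur i).1.1 _ xst).
  by apply: ae_on_imp u0 _ => y _ uy; rewrite /re_part uy mxE.
apply: (ae_on_lipschitz_eq0 st (ui i).1.1 _ xst).
by apply: ae_on_imp u0 _ => y _ uy; rewrite /im_part uy mxE.
Qed.

Definition cdirichlet s t u : 'rV[C]_(n + n) := row_mx (u s)^T (u t)^T.
Definition cneumann s t u1 : 'rV[C]_(n + n) := row_mx (- (u1 s)^T) (u1 t)^T.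

Lemma cdirichletE s t u : cdirichlet s t u =
  toC (dirichlet_data s t (re_part u)) + 'i *: toC (dirichlet_data s t (im_part u)).
Proof.
rewrite /dirichlet_data !map_row_mx scale_row_mx add_row_mx; congr row_mx;
by apply/rowP => i; rewrite !mxE [LHS]complexE.
Qed.

Lemma cneumannE s t u1 : cneumann s t u1 =
  toC (neumann_data s t (re_part u1)) + 'i *: toC (neumann_data s t (im_part u1)).
Proof.
rewrite /neumann_data !map_row_mx scale_row_mx add_row_mx; congr row_mx;
  apply/rowP => i; rewrite !mxE; last by rewrite [LHS]complexE.
by rewrite {1}[u1 s i ord0]complexE !rmorphN/= mulrN opprD.
Qed.

Lemma csol_dtn s t l E u u1 : dtn_matrix s t V l E -> csol s t l u u1 ->
  cneumann s t u1 = cdirichlet s t u *m toC E.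
Proof.
move=> HE [ur ui]; rewrite cneumannE cdirichletE (HE _ _ ur) (HE _ _ ui).
by rewrite mulmxDl -scalemxAl !map_mxM.
Qed.

End ComplexSolutions.

Section ShortComplex.
Variables (R : realType) (n : nat) (s t : R) (V : R -> 'M[R]_n) (M K : R).
Local Notation C := R[i].
Hypothesis st : s < t.
Hypothesis K0 : 0 <= K.
Hypothesis VM : ae_on s t (fun x => forall i k, `|V x i k| <= M).
Hypothesis mV : forall i k, measurable_fun `[s, t] (fun x => V x i k).
Hypothesis small : 144 * n.+1%:R * (K * (t - s) ^+ 2) <= 1.

Lemma csol_exists l (y z : 'rV[C]_n) : n%:R * M + `|l| <= K ->
  exists u u1, [/\ csol V s t l u u1, u s = y^T & u t = z^T].
Proof.
move=> lK.
have [f [f1 [sf fs ft]]] := sol_exists st K0 VM mV small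
  (fun i => complex.Re (y 0 i)) (fun i => complex.Re (z 0 i)) lK.
have [g [g1 [sg gs gt]]] := sol_exists st K0 VM mV small
  (fun i => complex.Im (y 0 i)) (fun i => complex.Im (z 0 i)) lK.
exists (fun x => \col_i Complex (f i x) (g i x)), (fun x => \col_i Complex (f1 i x) (g1 i x)).
have reE (h k : 'I_n -> R -> R) : re_part (fun x => \col_i Complex (h i x) (k i x)) = h.
  by apply/funext => i; apply/funext => x; rewrite /re_part mxE.
have imE (h k : 'I_n -> R -> R) : im_part (fun x => \col_i Complex (h i x) (k i x)) = k.
  by apply/funext => i; apply/funext => x; rewrite /im_part mxE.
split.
- by split; rewrite ?reE ?imE.
- by apply/colP => i; rewrite !mxE fs gs; case: (y 0 i).
- by apply/colP => i; rewrite !mxE ft gt; case: (z 0 i).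
Qed.

Lemma csol_eq0 l (u u1 : R -> 'cV[C]_n) : n%:R * M + `|l| <= K -> csol V s t l u u1 ->
  u s = 0 -> u t = 0 -> forall x, s <= x <= t -> u x = 0.
Proof.
move=> lK [ur ui] us ut x xst; apply/colP => i; rewrite mxE.
apply/eqP; rewrite eq_complex/=; apply/andP; split; apply/eqP.
  apply: (sol_eq0 st K0 VM small lK ur _ _ i xst).1;
    by move=> k; rewrite /re_part ?us ?ut mxE.
apply: (sol_eq0 st K0 VM small lK ui _ _ i xst).1;
  by move=> k; rewrite /im_part ?us ?ut mxE.
Qed.

End ShortComplex.

(** * Eigenfunctions and the kernel of the nodal matrix *)

Section Mesh.
Variables (R : realType) (n p : nat) (a b : R) (V : R -> 'M[R]_n) (M K : R).
Local Notation m := p.+1.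
Local Notation C := R[i].
Local Notation toC := (map_mx (real_complex R)).
Hypothesis ab : a < b.
Hypothesis K0 : 0 <= K.
Hypothesis VM : ae_on a b (fun x => forall i k, `|V x i k| <= M).
Hypothesis mV : forall i k, measurable_fun `[a, b] (fun x => V x i k).
Let h := (b - a) / m%:R.
Hypothesis small : 144 * n.+1%:R * (K * h ^+ 2) <= 1.
Implicit Types (th l : R) (u : R -> 'cV[C]_n).

Definition node (j : nat) : R := a + j%:R * ((b - a) / p.+1%:R).

Lemma node0 : node 0 = a. Proof. by rewrite /node mul0r addr0. Qed.

Lemma node_last : node m = b.
Proof. by rewrite /node mulrC divfK ?pnatr_eq0// addrC subrK. Qed.

Lemma nodeS j : node j.+1 - node j = h.
Proof. by rewrite /node -natr1 /h; ring. Qed.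

Lemma node_ltS j : node j < node j.+1.
Proof. by rewrite -subr_gt0 nodeS divr_gt0// subr_gt0. Qed.

Lemma node_le j k : (j <= k)%N -> node j <= node k.
Proof.
move=> jk; rewrite /node lerD2l ler_wpM2r ?ler_nat//.
by rewrite divr_ge0// subr_ge0 ltW.
Qed.

Lemma node_lt j k : (j < k)%N -> node j < node k.
Proof. by move=> jk; apply: lt_le_trans (node_ltS j) (node_le jk). Qed.

Lemma node_ge j : a <= node j. Proof. by rewrite -[X in X <= _]node0 node_le. Qed.

Lemma node_leb j : (j <= m)%N -> node j <= b.
Proof. by move=> jm; rewrite -node_last node_le. Qed.

Lemma cell_bound j : (j < m)%N ->
  ae_on (node j) (node j.+1) (fun x => forall i k, `|V x i k| <= M).
Proof. by move=> jm; apply: ae_on_sub VM; [exact: node_ge|exact: node_leb]. Qed.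

Lemma cell_measurable j : (j < m)%N ->
  forall i k, measurable_fun `[node j, node j.+1] (fun x => V x i k).
Proof.
move=> jm i k; apply: measurable_funS (mV i k) => //.
by apply: subset_itv; rewrite bnd_simp ?node_ge ?node_leb.
Qed.

Lemma cell_small j : 144 * n.+1%:R * (K * (node j.+1 - node j) ^+ 2) <= 1.
Proof. by rewrite nodeS. Qed.

(** By uniqueness in every cell. *)
Lemma csol_nodes_eq0 l u u1 : n%:R * M + `|l| <= K -> csol V a b l u u1 ->
  (forall j, (j <= m)%N -> u (node j) = 0) -> forall x, a <= x <= b -> u x = 0.
Proof.
move=> lK su u0.
suff H k : (k <= m)%N -> forall x, a <= x <= node k -> u x = 0.
  by move=> x; rewrite -node_last; exact: H.
elim: k => [_ x|k IH km x /andP[ax xk]].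
  by rewrite node0 => /le_anti <-; rewrite -[X in u X]node0 u0.
have [xk'|/ltW kx] := leP x (node k); first by apply: IH; rewrite ?ax ?xk'// ltnW.
apply: (csol_eq0 (node_ltS k) K0 (cell_bound km) (cell_small k) lK _ _ _ (x := x)).
- by apply: csol_sub su; [exact: node_ge|exact: node_leb].
- by rewrite u0// ltnW.
- by rewrite u0.
- by rewrite kx xk.
Qed.

Definition nodal_vector u : 'rV[C]_(m * n) := mxvec (\matrix_(j < m) (u (node j))^T).

Lemma nodal_vectorE th u j : u b = expi th *: u a -> (j <= m)%N ->
  nodal_vector u *m node_mx n p th j = (u (node j))^T.
Proof.
move=> ub; have lt_case k : (k < m)%N -> nodal_vector u *m node_mx n p th k = (u (node k))^T.
  move=> km; rewrite -[k]/(val (Ordinal km)) node_mx_lt mxvecK.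
  by apply/rowP => i; rewrite !mxE.
rewrite leq_eqVlt => /predU1P[->|/lt_case//].
by rewrite node_mx_last lt_case// node0 node_last ub linearZ.
Qed.

Section Kernel.
Variables (th l : R) (E : 'I_m -> 'M[R]_(n + n)).
Hypothesis lK : n%:R * M + `|l| <= K.
Hypothesis HE : forall j : 'I_m, dtn_matrix (node j) (node j.+1) V l (E j).

(** The contributions of the cells telescope to a boundary term at [a] and [b],
    which the boundary condition cancels. *)
Lemma nodal_vector_kernel u u1 : csol V a b l u u1 ->
  u b = expi th *: u a -> u1 b = expi th *: u1 a -> nodal_vector u *m nodal_mx th E = 0.
Proof.
move=> su ub u1b; rewrite /nodal_mx mulmx_sumr.
pose f j := (u1 (node j))^T *m (node_mx n p th j)^t*.
have term (j : 'I_m) : nodal_vector u *m (cell_mx n p th j *m toC (E j) *m (cell_mx n p th j)^t*)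
    = f j.+1 - f j.
  rewrite !mulmxA.
  have -> : nodal_vector u *m cell_mx n p th j = cdirichlet (node j) (node j.+1) u.
    by rewrite mul_mx_row !(nodal_vectorE ub)// ltnW.
  have sj : csol V (node j) (node j.+1) l u u1.
    by apply: csol_sub su; [exact: node_ge|exact: node_leb].
  rewrite -(csol_dtn (@HE j) sj) /cell_mx tr_row_mx map_col_mx mul_row_col mulNmx addrC.
  by [].
rewrite (eq_bigr _ (fun j _ => term j)) -(big_mkord xpredT (fun j => f j.+1 - f j)).
rewrite telescope_sumr// /f node_last node0 u1b linearZ/=.
have -> : node_mx n p th m = expi th *: node_mx n p th 0.
  by rewrite /node_mx ltnn /= scale1r.
rewrite [(expi th *: _)^T]linearZ/= map_mxZ/= -scalemxAl -scalemxAr scalerA expi_norm.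
by rewrite scale1r subrr.
Qed.

(** The solutions in the cells with the nodal values [x] match up with their
    derivatives, because testing [x *m nodal_mx th E = 0] against vectors supported
    at one node says that the normal derivatives there add up to zero. *)
Lemma kernel_csol x : x *m nodal_mx th E = 0 -> exists u u1,
  [/\ csol V a b l u u1, u b = expi th *: u a, u1 b = expi th *: u1 a & nodal_vector u = x].
Proof.
move=> xA; pose X j : 'rV[C]_n := x *m node_mx n p th j.
have /choice[w Hw] : forall j : nat, exists w : (R -> 'cV[C]_n) * (R -> 'cV[C]_n),
    (j < m)%N -> [/\ csol V (node j) (node j.+1) l w.1 w.2, w.1 (node j) = (X j)^T &
      w.1 (node j.+1) = (X j.+1)^T].
  move=> j; have [jm|jm] := boolP (j < m)%N; last by exists (fun=> 0, fun=> 0).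
  have [u [u1 H]] := csol_exists (node_ltS j) K0 (cell_bound jm) (cell_measurable jm)
    (cell_small j) (X j) (X j.+1) lK.
  by exists (u, u1).
pose P j := (w j).2 (node j); pose Q j := (w j).2 (node j.+1).
(* al lists the values at the nodes of the test vector supported at the node i *)
have balance (i : 'I_m) (al : nat -> C) :
    (forall k, (k <= m)%N ->
      al k = if (k < m)%N then (k == i)%:R else (i == 0 :> nat)%:R * expi th) ->
    \sum_(j < m) (al j.+1)^* *: Q j = \sum_(j < m) (al j)^* *: P j.
  move=> alE; pose Z := \sum_(j < m) (al j.+1)^* *: Q j - \sum_(j < m) (al j)^* *: P j.
  suff Z0 : Z = 0 by apply/eqP; rewrite -subr_eq0; apply/eqP.
  pose v := Z^T; pose y : 'rV[C]_(m * n) := mxvec (\matrix_(j < m) ((j == i)%:R *: v)).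
  have yN k : (k <= m)%N -> y *m node_mx n p th k = al k *: v.
    have lt_case k' : (k' < m)%N -> y *m node_mx n p th k' = (k' == i)%:R *: v.
      by move=> km; rewrite -[k']/(val (Ordinal km)) node_mx_lt mxvecK rowK.
    move=> km; rewrite alE//; case: ltnP => [/lt_case//|mk].
    have -> : k = m by apply/eqP; rewrite eqn_leq km.
    by rewrite node_mx_last lt_case// scalerA mulrC eq_sym.
  have term (j : 'I_m) : x *m cell_mx n p th j *m toC (E j) *m (y *m cell_mx n p th j)^t*
      = ((al j.+1)^* *: (Q j)^T - (al j)^* *: (P j)^T) *m v^t*.
    have [sw w0 w1] := Hw j (ltn_ord j).
    have -> : x *m cell_mx n p th j = cdirichlet (node j) (node j.+1) (w j).1.
      by rewrite mul_mx_row /cdirichlet w0 w1 !trmxK.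
    rewrite -(csol_dtn (@HE j) sw) mul_mx_row !yN//; last exact: ltnW.
    rewrite tr_row_mx map_col_mx mul_row_col !linearZ/= !map_mxZ/= -!scalemxAr mulNmx.
    by rewrite mulmxDl -!scalemxAl mulNmx addrC.
  have := nodal_form th E x y; rewrite xA mul0mx (eq_bigr _ (fun j _ => term j)).
  rewrite -mulmx_suml sumrB => /esym/(congr1 (fun D : 'M[C]_1 => D 0 0)).
  have -> : \sum_(j < m) (al j.+1)^* *: (Q j)^T - \sum_(j < m) (al j)^* *: (P j)^T = v.
    by rewrite /v /Z -!sumrB linear_sum/=; apply: eq_bigr => j _; rewrite linearB/= !linearZ.
  rewrite -sqnormE mxE => v0; apply/trmx_inj; rewrite trmx0 -/v; apply/eqP/negPn/negP => vn0.
  by have := sqnorm_gt0 vn0; rewrite v0 ltxx.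
have match_node i : (0 < i)%N -> (i < m)%N -> Q i.-1 = P i.
  move=> i0 im; have im1 : (i.-1 < m)%N by apply: leq_ltn_trans im; exact: leq_pred.
  have := balance (Ordinal im) (fun k => (k == i)%:R) _ => /(_ _)/wrap[].
    move=> k km /=; case: ltnP => // mk; rewrite [i == 0%N]gtn_eqF// mul0r.
    by rewrite gtn_eqF// (leq_trans im).
  rewrite (bigD1 (Ordinal im1))//= prednK// eqxx conjC1 scale1r big1 ?addr0; last first.
    move=> j ji; rewrite (_ : (j.+1 == i) = false) ?conjC0 ?scale0r//.
    by apply: contraNF ji => /eqP ji; apply/eqP/val_inj; rewrite /= -ji.
  rewrite (bigD1 (Ordinal im))//= eqxx conjC1 scale1r big1 ?addr0// => j ji.
  rewrite (_ : (j == i :> nat) = false) ?conjC0 ?scale0r//.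
  by apply: contraNF ji => /eqP ji; apply/eqP/val_inj.
have match_ends : Q p = expi th *: P 0%N.
  have := balance ord0 (fun k => if (k < m)%N then (k == 0)%:R else expi th) _ => /(_ _)/wrap[].
    by move=> k km /=; rewrite mul1r.
  rewrite (bigD1 ord_max)//= ltnn big1 ?addr0; last first.
    move=> j jp; rewrite ifT ?conjC0 ?scale0r// ltn_neqAle (ltn_ord j) andbT eqSS.
    by apply: contra jp => /eqP jp; apply/eqP/val_inj.
  rewrite (bigD1 ord0)//= conjC1 scale1r big1 ?addr0; last first.
    by move=> j j0; rewrite ltn_ord (_ : (j == 0 :> nat) = false) ?conjC0 ?scale0r//; apply: negbTE.
  by move=> <-; rewrite scalerA expi_norm scale1r.
(* glue the cells one by one, from the left *)
suff H k : (k < m)%N -> exists u u1, [/\ csol V a (node k.+1) l u u1,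
    forall j, (j <= k.+1)%N -> u (node j) = (X j)^T, u1 a = P 0%N & u1 (node k.+1) = Q k].
  have [u [u1 [su uX u1a u1b]]] := H p (ltnSn p).
  rewrite node_last in su u1b; exists u, u1; split => //.
  - by rewrite -[in LHS]node_last -[in RHS]node0 !uX// /X node_mx_last linearZ.
  - by rewrite u1b u1a.
  - apply: (can_inj (@vec_mxK _ m n)); rewrite mxvecK; apply/row_matrixP => j.
    have jm : (j <= m)%N by exact: ltnW.
    by rewrite rowK (uX _ jm) trmxK; exact: node_mx_lt.
elim: k => [|k IH] km.
  have [sw w0 w1] := Hw 0%N km; exists (w 0%N).1, (w 0%N).2; split.
  - by rewrite node0 in sw.
  - by case=> [_|[_|j]]; [exact: w0|exact: w1|move=> j1; exfalso].
  - by rewrite /P node0.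
  - by [].
have [u [u1 [su uX u1a u1b]]] := IH (ltnW km); have [sw w0 w1] := Hw k.+1 km.
exists (fun x => if x < node k.+1 then u x else (w k.+1).1 x),
  (fun x => if x < node k.+1 then u1 x else (w k.+1).2 x); split.
- apply: (csol_glue (node_ge _) (ltW (node_ltS _)) _ _ su sw).
    by rewrite uX// w0.
  by rewrite u1b; exact: (match_node k.+1).
- move=> j; rewrite leq_eqVlt => /predU1P[->|].
    by rewrite ltNge (ltW (node_ltS _)).
  rewrite ltnS leq_eqVlt => /predU1P[->|jk]; first by rewrite ltxx.
  by rewrite (node_lt jk); exact: (uX j (ltnW jk)).
- by rewrite -{1}node0 node_lt.
- by rewrite ltNge (ltW (node_ltS _)).
Qed.

End Kernel.
End Mesh.

(** * Representatives of eigenfunctions *)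

Section LebesgueSpaces.
Variable R : realType.
Implicit Types (a b x B : R) (f : R -> R).
Local Notation mu := (@lebesgue_measure R).

Lemma Lp_on_measurable a b (q : \bar R) f : Lp_on a b q f -> measurable_fun `[a, b] f.
Proof.
rewrite /Lp_on inE => /andP[]; rewrite inE/= => mf _.
by apply/(measurable_restrictT _ _).2.
Qed.

Lemma Loo_on_bounded a b f : Lp_on a b +oo%E f ->
  exists M, ae_on a b (fun x => `|f x| <= M).
Proof.
rewrite /Lp_on inE => /andP[_]; rewrite inE/= /finite_norm unlock /Lnorm.
have -> : (0 < mu [set: R])%E.
  apply: (@lt_le_trans _ _ (mu `[0, 1])).
    by rewrite lebesgue_measure_itv/= lte_fin ltr01 -EFinD lte_fin subr0.
  by apply: le_measure; rewrite ?inE.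
move=> foo; set y := ess_sup _ _ in foo.
have := ess_sup_ge mu (abse \o (EFin \o f \_ `[a, b])); rewrite -/y => fy.
exists (fine y); rewrite /ae_on; apply: filterS fy => x /= fy xab.
move: foo fy; rewrite patchE mem_set//=; clearbody y; by case: y.
Qed.

Lemma bounded_L2_on a b B f : measurable_fun `[a, b] f ->
  ae_on a b (fun x => `|f x| <= B) -> Lp_on a b 2%:E f.
Proof.
move=> mf fB; have mg : measurable_fun setT (f \_ `[a, b]) by apply/(measurable_restrictT _ _).1.
rewrite /Lp_on inE; apply/andP; split; rewrite inE//=.
rewrite /finite_norm unlock poweR_lty//.
apply: (@le_lt_trans _ _ (\int[mu]_x ((cst (`|B| `^ 2)%:E) \_ `[a, b]) x)%E).
  apply: ae_ge0_le_integral => //.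
  - by move=> x _; exact: poweR_ge0.
  - apply: (measurableT_comp (measurable_poweR _)).
    by apply: measurableT_comp => //; exact/measurable_EFinP.
  - by move=> x _; rewrite patchE; case: ifP => // _; rewrite lee_fin powR_ge0.
  - by apply/(measurable_restrictT _ _).1.
  - rewrite /ae_on in fB; apply: filterS fB => x fB _.
    rewrite /= !patchE; case: ifPn => [|_]; last by rewrite normr0 powR0.
    rewrite inE/= => xab; rewrite lee_fin; apply: ge0_ler_powR; rewrite ?nnegrE//.
    by apply: le_trans (ler_norm _); exact: fB.
rewrite -integral_mkcond integral_cst//.
apply: lte_mul_pinfty; [by rewrite lee_fin powR_ge0|by []|].
have : (mu `[a, b] < +oo)%E; last by [].
by rewrite lebesgue_measure_itv/=; case: ifP; rewrite -?EFinD ltry.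
Qed.

Lemma abs_continuous_bounded a b f : a <= b -> abs_continuous a b f ->
  exists B, forall x, a <= x <= b -> `|f x| <= B.
Proof.
move=> ab af.
have cf : {within `[a, b], continuous f}.
  apply/subspace_continuousP => x /=; rewrite in_itv/= => xab.
  apply/cvgrPdist_lt => e e0; have [d d0 H] := af e e0.
  have key y z : a <= y -> y < z -> z <= b -> z - y < d -> `|f z - f y| < e.
    move=> ay yz zb zyd; have := H 1%N (fun=> y) (fun=> z).
    rewrite !big_ord1; apply => //.
    by apply/trivIsetP => i j _ _; rewrite !ord1 eqxx.
  suff : \forall y \near x, a <= y <= b -> `|f x - f y| < e.
    by apply: filterS => y H' /=; rewrite in_itv/= => /H'.
  have : \forall y \near x, `|x - y| < d by exact: nbhsx_ballx.
  apply: filterS => y xyd /andP[ay yb]; move/andP: xab => [ax xb].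
  have [yx|xy|->] := ltgtP y x; last by rewrite subrr normr0.
    by apply: key => //; apply: le_lt_trans xyd; exact: ler_norm.
  by rewrite distrC; apply: key => //; apply: le_lt_trans xyd; rewrite distrC ler_norm.
have cnf : {within `[a, b], continuous (fun x => `|f x|)}.
  by move=> x; apply: continuous_comp; [exact: cf|exact: norm_continuous].
have [c _ H] := EVT_max ab cnf.
by exists `|f c| => x xab; apply: H; rewrite in_itv/=.
Qed.

End LebesgueSpaces.

Section Eigenfunctions.
Variables (R : realType) (n : nat) (a b : R) (V : R -> 'M[R]_n) (M : R).
Local Notation C := R[i].
Hypothesis ab : a < b.
Hypothesis VM : ae_on a b (fun x => forall i k, `|V x i k| <= M).
Hypothesis mV : forall i k, measurable_fun `[a, b] (fun x => V x i k).
Implicit Types (th l x : R) (u : R -> 'cV[C]_n).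

(** Bootstrap: [f] is bounded, so the second derivative is bounded and [f1] is
    Lipschitz, so [f1] is bounded and [f] is Lipschitz. *)
Lemma abs_continuous_sch_sol l (f f1 f2 : 'I_n -> R -> R) :
  (forall i, abs_continuous a b (f i)) -> (forall i, abs_continuous a b (f1 i)) ->
  (forall i, ae_on a b (fun x => is_derive x 1 (f i) (f1 i x))) ->
  (forall i, ae_on a b (fun x => is_derive x 1 (f1 i) (f2 i x))) ->
  (forall i, ae_on a b (fun x => f2 i x = sch_rhs V l f i x)) ->
  sch_sol a b V l f f1.
Proof.
move=> af af1 df df1 f2E.
have /choice[B fB] := fun i => abs_continuous_bounded (ltW ab) (af i).
have fB' i x : a <= x <= b -> `|f i x| <= \sum_k `|B k|.
  move=> xab; apply: le_trans (fB i x xab) _.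
  by rewrite (bigD1 i)//= (le_trans (ler_norm _))// lerDl sumr_ge0.
move=> i.
have pf1 : prim a b (f1 i) (sch_rhs V l f i).
  apply: (@abs_continuous_prim _ _ _ _ _ ((n%:R * M + `|l|) * \sum_k `|B k|)) => //.
    by apply: ae_on_and (df1 i) (f2E i) _ => x _ + <-.
  exact: sch_rhs_bound.
split => //.
have [B1 _ f1B] := lipschitz_itv_bounded pf1.1.
by apply: abs_continuous_prim (df i) (ae_on_all f1B); exact: af.
Qed.

Lemma Re_real_complex_mul (c : R) (z : C) :
  (complex.Re (real_complex R c * z) = c * complex.Re z) *
  (complex.Im (real_complex R c * z) = c * complex.Im z).
Proof. by case: z => x y /=; split; ring. Qed.

Lemma part_rhs l u x i :
  (complex.Re ((map_mx (real_complex R) (V x) *m u x - real_complex R l *: u x) i ord0)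
     = sch_rhs V l (re_part u) i x) *
  (complex.Im ((map_mx (real_complex R) (V x) *m u x - real_complex R l *: u x) i ord0)
     = sch_rhs V l (im_part u) i x).
Proof.
have E : (map_mx (real_complex R) (V x) *m u x - real_complex R l *: u x) i ord0 =
    \sum_k real_complex R (V x i k) * u x k ord0 - real_complex R l * u x i ord0.
  by rewrite !mxE; congr (_ - _); apply: eq_bigr => k _; rewrite mxE.
rewrite {}E /sch_rhs; split; rewrite raddfB/= Re_real_complex_mul raddf_sum/=;
by congr (_ - _); apply: eq_bigr => k _; rewrite Re_real_complex_mul.
Qed.

Lemma ker_H_sub_csol th l u : ker_H_sub a b V th l u ->
  exists u1, [/\ csol V a b l u u1, u b = expi th *: u a & u1 b = expi th *: u1 a].
Proof.
move=> [u1 [u2 [[[au au1 du du1] [_ ub u1b]] fE]]]; exists u1; split => //.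
have u2E : ae_on a b (fun x => u2 x =
    map_mx (real_complex R) (V x) *m u x - real_complex R l *: u x).
  by apply: ae_on_imp fE _ => x _ ->; rewrite opprD opprK addrCA subrr addr0.
split; apply: (abs_continuous_sch_sol (f2 := _)).
- by move=> i; exact: (au i).1.
- by move=> i; exact: (au1 i).1.
- by move=> i; apply: ae_on_imp du _ => x _ H; exact: (H i).1.
- move=> i; apply: (ae_on_imp
    (S := fun x => is_derive x 1 (re_part u1 i) (re_part u2 i x))) du1 _ => x _ H.
  exact: (H i).1.
- by move=> i; apply: ae_on_imp u2E _ => x _ ux; rewrite /re_part ux part_rhs.
- by move=> i; exact: (au i).2.
- by move=> i; exact: (au1 i).2.
- by move=> i; apply: ae_on_imp du _ => x _ H; exact: (H i).2.
- move=> i; apply: (ae_on_imp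
    (S := fun x => is_derive x 1 (im_part u1 i) (im_part u2 i x))) du1 _ => x _ H.
  exact: (H i).2.
- by move=> i; apply: ae_on_imp u2E _ => x _ ux; rewrite /im_part ux part_rhs.
Qed.

Lemma csol_ker_H_sub th l u u1 : csol V a b l u u1 -> u b = expi th *: u a ->
  u1 b = expi th *: u1 a -> ker_H_sub a b V th l u.
Proof.
move=> [ur ui] ub u1b.
pose u2 x := map_mx (real_complex R) (V x) *m u x - real_complex R l *: u x.
exists u1, u2; split; last first.
  by apply: ae_on_all => x _; rewrite /u2 opprB subrK.
have L2 (f f1 : 'I_n -> R -> R) : sch_sol a b V l f f1 ->
    forall i, Lp_on a b 2%:E (sch_rhs V l f i).
  move=> sf i.
  have /choice[B fB] := fun k =>
    abs_continuous_bounded (ltW ab) (lipschitz_itv_abs_continuous (sf k).1.1).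
  have fB' k x : a <= x <= b -> `|f k x| <= \sum_k `|B k|.
    move=> xab; apply: le_trans (fB k x xab) _.
    by rewrite (bigD1 k)//= (le_trans (ler_norm _))// lerDl sumr_ge0.
  apply: bounded_L2_on (sch_rhs_bound l VM fB' i).
  by apply: sch_rhs_measurable => // k; exact: (sf k).1.1.
split; split => //.
- by move=> i; split; apply: lipschitz_itv_abs_continuous; [exact: (ur i).1.1|exact: (ui i).1.1].
- by move=> i; split; apply: lipschitz_itv_abs_continuous; [exact: (ur i).2.1|exact: (ui i).2.1].
- apply: ae_on_forall => i.
  by apply: ae_on_and (ur i).1.2 (ui i).1.2 _ => x _ H1 H2; split.
- apply: ae_on_forall => i.
  apply: ae_on_and (ur i).2.2 (ui i).2.2 _ => x _ H1 H2; split.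
    by rewrite /u2 part_rhs.
  by rewrite /u2 part_rhs.
- move=> i; split.
    have := L2 _ _ ur i; congr (Lp_on _ _ _ _).
    by apply/funext => x; rewrite /u2 part_rhs.
  have := L2 _ _ ui i; congr (Lp_on _ _ _ _).
  by apply/funext => x; rewrite /u2 part_rhs.
Qed.

End Eigenfunctions.

(** * Reduction to finite dimension *)

Section Dimension.
Variables (R : realType) (n p : nat) (a b : R) (V : R -> 'M[R]_n) (M K : R).
Local Notation m := p.+1.
Local Notation C := R[i].
Hypothesis ab : a < b.
Hypothesis K0 : 0 <= K.
Hypothesis VM : ae_on a b (fun x => forall i k, `|V x i k| <= M).
Hypothesis mV : forall i k, measurable_fun `[a, b] (fun x => V x i k).
Hypothesis small : 144 * n.+1%:R * (K * ((b - a) / m%:R) ^+ 2) <= 1.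
Variables (th l : R) (E : 'I_m -> 'M[R]_(n + n)).
Hypothesis lK : n%:R * M + `|l| <= K.
Hypothesis HE : forall j : 'I_m, dtn_matrix (node p a b j) (node p a b j.+1) V l (E j).

Lemma nodal_vector_sum k (c : 'I_k -> C) (u : 'I_k -> R -> 'cV[C]_n) :
  nodal_vector p a b (fun x => \sum_j c j *: u j x) =
  \sum_j c j *: nodal_vector p a b (u j).
Proof.
apply: (can_inj (@vec_mxK _ m n)); rewrite mxvecK linear_sum/=.
apply/row_matrixP => i; rewrite rowK linear_sum/= [RHS]linear_sum/=.
by apply: eq_bigr => j _; rewrite !linearZ/= mxvecK rowK.
Qed.

(** Passing to nodal values is injective on solutions, so it preserves linear
    independence in both directions. *)
Lemma dimC_nodal : dimC a b (ker_H_sub a b V th l) =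
  (\rank (kermx (nodal_mx th E)))%:R%:E.
Proof.
apply/le_anti/andP; split.
  apply: ge_ereal_sup => _ [k [u [uker uindep]] <-]; rewrite lee_fin ler_nat.
  have /choice[u1 Hu1] : forall j, exists u1, [/\ csol V a b l (u j) u1,
      u j b = expi th *: u j a & u1 b = expi th *: u1 a].
    by move=> j; exact: (ker_H_sub_csol ab VM (uker j)).
  pose X := \matrix_j nodal_vector p a b (u j).
  have XK : (X <= kermx (nodal_mx th E))%MS.
    apply/row_subP => j; rewrite rowK; apply/sub_kermxP.
    have [su ub u1b] := Hu1 j; exact: (nodal_vector_kernel ab HE su ub u1b).
  suff /eqP <- : row_free X by exact: mxrankS.
  rewrite -kermx_eq0; apply/rowV0P => v /sub_kermxP vX.
  have su := csol_sum (v 0) (fun j => let: And3 s _ _ := Hu1 j in s).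
  have ub : \sum_j v 0 j *: u j b = expi th *: \sum_j v 0 j *: u j a.
    rewrite scaler_sumr; apply: eq_bigr => j _; have [_ -> _] := Hu1 j.
    by rewrite !scalerA mulrC.
  have u0 : nodal_vector p a b (fun x => \sum_j v 0 j *: u j x) = 0.
    rewrite nodal_vector_sum -[RHS]vX mulmx_sum_row.
    by apply: eq_bigr => j _; rewrite rowK.
  have un0 j : (j <= m)%N -> \sum_k v 0 k *: u k (node p a b j) = 0.
    move=> jm; have := nodal_vectorE (u := fun x => \sum_j v 0 j *: u j x) ub jm.
    by rewrite u0 mul0mx => /esym/eqP; rewrite -trmx0 (inj_eq trmx_inj) => /eqP.
  have z := csol_nodes_eq0 ab K0 VM small lK su un0.
  by apply/rowP => j; rewrite [RHS]mxE; apply: uindep; apply: ae_on_all => x; exact: z.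
apply: ereal_sup_ubound; exists (\rank (kermx (nodal_mx th E))) => //.
pose B := row_base (kermx (nodal_mx th E)).
have /choice[u Hu] : forall j, exists u, (exists u1, csol V a b l u u1) /\
    ker_H_sub a b V th l u /\ nodal_vector p a b u = row j B.
  move=> j; have /sub_kermxP Bj : (row j B <= kermx (nodal_mx th E))%MS.
    by apply: submx_trans (row_sub j B) _; rewrite eq_row_base.
  have [u [u1 [su ub u1b uB]]] := kernel_csol ab K0 VM mV small lK HE Bj.
  exists u; split; first by exists u1.
  by split=> //; exact: (csol_ker_H_sub ab VM mV su ub u1b).
exists u; split; first by move=> j; exact: (Hu j).2.1.
move=> c c0 j.
have /choice[u1 Hu1] := fun j => (Hu j).1.
have z := csol_ae_eq0 ab (csol_sum c Hu1) c0.
have cB : (\row_j c j) *m B = 0.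
  rewrite mulmx_sum_row; have := nodal_vector_sum c u.
  under [X in _ = X -> _]eq_bigr do rewrite (Hu _).2.2.
  under [X in _ -> X = _]eq_bigr do rewrite mxE.
  move=> <-; rewrite /nodal_vector (_ : \matrix_j _ = 0) ?linear0//.
  apply/row_matrixP => i; rewrite rowK row0 z ?trmx0//.
  by rewrite node_ge// node_leb// ltnW.
have : (\row_j c j) == 0.
  by rewrite -(mulmx_free_eq0 _ (row_base_free (kermx (nodal_mx th E)))) cB.
by move=> /eqP/rowP/(_ j); rewrite !mxE.
Qed.

End Dimension.

Section Reduction.
Variables (R : realType) (n : nat) (a b : R) (V : R -> 'M[R]_n) (M : R).
Local Notation C := R[i].
Hypothesis ab : a < b.
Hypothesis M0 : 0 <= M.
Hypothesis VM : ae_on a b (fun x => forall i k, `|V x i k| <= M).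
Hypothesis mV : forall i k, measurable_fun `[a, b] (fun x => V x i k).
Hypothesis Vsym : ae_on a b (fun x => V x = (V x)^T).
Implicit Types (th l : R).

(** For energies in a bounded range one mesh is fine enough, and the eigenvalue
    problem is reduced to the values at its nodes. The space [W] consists of the
    vectors that vanish at the node 0; its codimension is at most [n]. *)
Lemma finite_reduction (Lam : R) : 0 <= Lam ->
  exists N (A : R -> R -> 'M[C]_N) (W : 'M[C]_N),
  [/\ forall th l, `|l| <= Lam -> A th l \is hermsymmx,
      forall th l l' x, `|l| <= Lam -> `|l'| <= Lam -> l < l' -> x != 0 ->
        qform (A th l') x < qform (A th l) x &
      forall th l (e : C), `|l| <= Lam -> 0 < e -> exists2 d, 0 < d &
        forall l', `|l'| <= Lam -> `|l' - l| < d ->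
        forall q1 q2, `|(A th l' - A th l) q1 q2| <= e] /\
  [/\ forall th l x, `|l| <= Lam -> l <= - (n%:R * M) -> 0 <= qform (A th l) x,
      forall th l, `|l| <= Lam ->
        dimC a b (ker_H_sub a b V th l) = (\rank (kermx (A th l)))%:R%:E,
      (N <= \rank W + n)%N &
      forall th th' l x, (x <= W)%MS -> qform (A th l) x = qform (A th' l) x].
Proof.
move=> L0; pose K := n%:R * M + Lam.
have K0 : 0 <= K by rewrite addr_ge0// mulr_ge0.
have lK l : `|l| <= Lam -> n%:R * M + `|l| <= K by move=> lL; rewrite lerD2l.
have [p small] : exists p, 144 * n.+1%:R * (K * ((b - a) / p.+1%:R) ^+ 2) <= 1.
  pose X := 144 * n.+1%:R * (K * (b - a) ^+ 2).
  exists (Num.truncn X); rewrite expr_div_n !mulrA ler_pdivrMr ?exprn_gt0// mul1r.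
  apply: (@le_trans _ _ (Num.truncn X).+1%:R).
    by apply: le_trans (ltW (truncnS_gt X)); rewrite /X !mulrA.
  by rewrite -natrX ler_nat leq_pmulr.
have /choice[E HE] : forall lj : R * 'I_p.+1, exists E : 'M[R]_(n + n), `|lj.1| <= Lam ->
    dtn_matrix (node p a b lj.2) (node p a b lj.2.+1) V lj.1 E.
  move=> [l j] /=; have [lL|nL] := pselect (`|l| <= Lam); last by exists 0.
  have [E HE] := dtn_matrix_exists (node_ltS p ab j) K0 (cell_bound ab VM (ltn_ord j))
    (cell_measurable ab mV (ltn_ord j)) (cell_small small j) (lK l lL).
  by exists E.
have Vsymj (j : 'I_p.+1) :
    ae_on (node p a b j) (node p a b j.+1) (fun x => V x = (V x)^T).
  by apply: ae_on_sub Vsym; [exact: node_ge|exact: node_leb].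
have EL l (j : 'I_p.+1) : `|l| <= Lam ->
    dtn_matrix (node p a b j) (node p a b j.+1) V l (E (l, j)) by exact: (HE (l, j)).
have symE l (j : 'I_p.+1) : `|l| <= Lam -> (E (l, j))^T = E (l, j).
  move=> lL; exact: (dtn_sym (node_ltS p ab j) K0 (cell_bound ab VM (ltn_ord j))
    (cell_measurable ab mV (ltn_ord j)) (Vsymj j) (cell_small small j) (lK l lL) (EL l j lL)).
exists (p.+1 * n)%N, (fun th l => nodal_mx th (fun j => E (l, j))), (kermx (node_mx n p 0 0)).
split; split.
- by move=> th l lL; apply: nodal_hermitian => j; exact: symE.
- move=> th l l' x lL l'L ll' x0; apply: nodal_decreasing => // [j|j|j w w0]; try exact: symE.
  exact: (dtn_decreasing (node_ltS p ab j) K0 (cell_bound ab VM (ltn_ord j))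
    (cell_measurable ab mV (ltn_ord j)) (Vsymj j) (cell_small small j) (lK l lL) (lK l' l'L)
    (EL l j lL) (EL l' j l'L) ll' w0).
- move=> th l e lL e0; have [d d0 Hd] := nodal_close n p th e0.
  pose c : R := 16 * n%:R * ((b - a) / p.+1%:R) + 1.
  have c0 : 0 < c.
    by rewrite /c ltr_wpDl// !mulr_ge0// ?invr_ge0// subr_ge0 ltW.
  exists (d / c); first exact: divr_gt0.
  move=> l' l'L ll' q1 q2; rewrite -nodal_mxB; apply: Hd => j k1 k2.
  rewrite mxE [X in _ + X]mxE.
  apply: le_trans (dtn_lipschitz (node_ltS p ab j) K0 (cell_bound ab VM (ltn_ord j))
    (cell_measurable ab mV (ltn_ord j)) (Vsymj j) (cell_small small j) (lK l' l'L) (lK l lL)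
    (EL l' j l'L) (EL l j lL) k1 k2) _.
  rewrite nodeS; move: ll'; rewrite ltr_pdivlMr// distrC => ll'.
  apply: le_trans (ltW ll'); by rewrite mulrC ler_wpM2l// /c lerDl.
- move=> th l x lL lM; apply: nodal_ge0 => [j|j w]; first exact: symE.
  exact: (dtn_ge0 (node_ltS p ab j) K0 M0 (cell_bound ab VM (ltn_ord j))
    (cell_measurable ab mV (ltn_ord j)) (cell_small small j) w (lK l lL) (EL l j lL) lM).
- by move=> th l lL; exact: (dimC_nodal ab K0 VM mV small th (lK l lL) (fun j => EL l j lL)).
- rewrite mxrank_ker; have := rank_leq_col (node_mx n p (0 : R) 0).
  by move: (\rank _) => q qn; lia.
- by move=> th th' l x /sub_kermxP x0; exact: nodal_theta.
Qed.

(** Compare with the energy -n M, on a mesh that is fine enough for both. *)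
Lemma dimC_low th l : l < - (n%:R * M) -> dimC a b (ker_H_sub a b V th l) = 0%E.
Proof.
move=> lM; pose Lam := `|l|; have nM0 : 0 <= n%:R * M by rewrite mulr_ge0.
have [N [A [W [[_ dec _] [pos dimE _ _]]]]] := finite_reduction (normr_ge0 l).
rewrite dimE//; suff -> : kermx (A th l) = 0 by rewrite mxrank0.
have nL : `|- (n%:R * M)| <= `|l| by rewrite !ler0_norm; lra.
apply/row_matrixP => i; rewrite row0; apply/eqP/negPn/negP => x0.
have := dec th l (- (n%:R * M)) _ (lexx _) nL lM x0.
rewrite [X in _ < X]/qform (_ : row i _ *m A th l = 0); last first.
  by apply/sub_kermxP; exact: row_sub.
by rewrite mul0mx mxE => /(le_lt_trans (pos th _ _ nL (lexx _))); rewrite ltxx.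
Qed.

(** The index of [A th l] grows with [l] exactly by the dimensions of the kernels
    that are met, and vanishes for low energies. *)
Lemma N_lt_index r : exists f : R -> nat, (forall th, N_lt a b V r th = (f th)%:R%:E) /\
  forall th th', (f th <= f th' + n)%N.
Proof.
pose Lam := `|r| + n%:R * M; have nM0 : 0 <= n%:R * M by rewrite mulr_ge0.
have L0 : 0 <= Lam by rewrite addr_ge0.
have [N [A [W [[herm dec near] [pos dimE NW AW]]]]] := finite_reduction L0.
have rL : `|r| <= Lam by rewrite lerDl.
exists (fun th => morse_index (A th r)); split; last first.
  move=> th th'; have := morse_index_codim (herm th r rL) (herm th' r rL) (AW th th' r).
  move: NW; move: (\rank W) (morse_index (A th r)) (morse_index (A th' r)) => q i i'; lia.
move=> th; pose l0 := Num.min r (- (n%:R * M)).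
have l0r : l0 <= r by rewrite ge_min lexx.
have l0M : l0 <= - (n%:R * M) by rewrite ge_min lexx orbT.
have lL l : l0 <= l -> l <= r -> `|l| <= Lam.
  move=> l0l lr; have := ler_norm r; have := ler_norm (- r); rewrite normrN => r1 r2.
  have : - Lam <= l0 by rewrite /Lam le_min; apply/andP; split; lra.
  by rewrite ler_norml /Lam => ?; apply/andP; split; lra.
pose k l := if l < l0 then 0%N else \rank (kermx (A th l)).
rewrite /N_lt (@eq_esum _ _ _ _ (fun l => (k l)%:R%:E)); last first.
  move=> l /= lr; rewrite /k; case: ltP => l0l; first by rewrite dimC_low// (lt_le_trans l0l).
  by rewrite dimE// lL// ltW.
apply: (@esum_jumps _ (fun l => morse_index (A th l)) k l0 r) => //.
- by move=> l ll0; rewrite /k ll0.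
- by apply: morse_index_eq0 => [|x]; [apply: herm|apply: pos] => //; exact: lL.
- move=> l l' l0l ll' l'r.
  have l1 : `|l| <= Lam by apply: lL => //; exact: le_trans (ltW ll') l'r.
  have l2 : `|l'| <= Lam by apply: lL => //; exact: le_trans l0l (ltW ll').
  rewrite /k ltNge l0l/=; apply: morse_index_lt; [exact: herm|exact: herm|].
  by move=> x; exact: dec.
- move=> l l0l lr; have l1 := lL l l0l lr; rewrite /k ltNge l0l/=.
  have [e e0 He] := morse_index_near (herm th l l1).
  have [d d0 Hd] := near th l e l1 e0; exists d => // l' l0l' l'r ll'.
  have l2 := lL l' l0l' l'r.
  by apply: He; [exact: herm|exact: Hd].
Qed.

End Reduction.

(** * The counting functions *)

Section CountingFunctions.
Variables (R : realType) (n : nat) (a b : R) (V : R -> 'M[R]_n).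

Lemma dimC_ge0 (S : set (R -> 'cV[R[i]]_n)) : (0 <= dimC a b S)%E.
Proof.
apply: ereal_sup_ubound; exists 0%N => //.
by exists (fun=> fun=> 0); split => [[]|c _ []].
Qed.

Lemma N_lt_split r1 r2 th : r1 <= r2 ->
  (N_lt a b V r2 th = N_lt a b V r1 th + N_itv a b V r1 r2 th)%E.
Proof. by move=> r12; apply: esum_split_lt => // l; exact: dimC_ge0. Qed.

Lemma dist_nat_le (i j k : nat) : (i <= j + k)%N -> (j <= i + k)%N ->
  `|i%:R - j%:R : R| <= k%:R.
Proof.
rewrite -(ler_nat R) natrD => H1; rewrite -(ler_nat R) natrD => H2.
by rewrite ler_norml; apply/andP; split; lra.
Qed.

Lemma counting_functions_close : a < b ->
  (forall i j : 'I_n, Lp_on a b +oo%E (fun x => V x i j)) ->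
  ae_on a b (fun x => V x = (V x)^T) ->
  forall r1 r2 th th', r1 <= r2 ->
  (`| N_lt a b V r1 th' - N_lt a b V r1 th | <= n%:R%:E)%E /\
  (`| N_itv a b V r1 r2 th' - N_itv a b V r1 r2 th | <= (2 * n)%N%:R%:E)%E.
Proof.
move=> ab hV Vsym r1 r2 th th' r12.
have mV i k := Lp_on_measurable (hV i k).
have /choice[B HB] : forall ik : 'I_n * 'I_n, exists B, ae_on a b (fun x => `|V x ik.1 ik.2| <= B).
  by move=> [i k]; exact: Loo_on_bounded.
pose M := \sum_ik `|B ik|.
have M0 : 0 <= M by exact: sumr_ge0.
have VM : ae_on a b (fun x => forall i k, `|V x i k| <= M).
  apply: ae_on_imp (ae_on_forall HB) _ => x _ H i k; apply: le_trans (H (i, k)) _.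
  by rewrite /M (bigD1 (i, k))//= (le_trans (ler_norm _))// lerDl sumr_ge0.
have [f1 [N1 f1n]] := N_lt_index ab M0 VM mV Vsym r1.
have [f2 [N2 f2n]] := N_lt_index ab M0 VM mV Vsym r2.
have NI t : N_itv a b V r1 r2 t = ((f2 t)%:R - (f1 t)%:R : R)%:E.
  have := N_lt_split t r12; rewrite N1 N2.
  case: (N_itv _ _ _ _ _ _) => [c| |]//; rewrite -EFinD => -[E].
  by congr (_%:E); rewrite E; ring.
rewrite !N1 !NI -!EFinB !abse_EFin !lee_fin; split; first exact: dist_nat_le.
have := dist_nat_le (f1n th' th) (f1n th th'); have := dist_nat_le (f2n th' th) (f2n th th').
rewrite !ler_norml natrM => /andP[? ?] /andP[? ?]; apply/andP; split; lra.
Qed.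

End CountingFunctions.

Local Close Scope classical_set_scope.

Theorem corollary3p4 (R : realType) (a b : R) (hab : a < b)
    (n : nat) (hn : (1 <= n)%N) (V : R -> 'M[R]_n)
    (hV : forall i j : 'I_n, Lp_on a b +oo%E (fun x => V x i j))
    (hVsym : ae_on a b (fun x => V x = (V x)^T))
    (r r1 r2 : R) (hr : r1 < r2) :
  (forall theta1 theta2 : R,
     0 <= theta1 -> theta1 < theta2 -> theta2 < 2 * pi ->
     (`| N_lt a b V r theta2 - N_lt a b V r theta1 | <= (2 * n)%N%:R%:E)%E /\
     (`| N_itv a b V r1 r2 theta2 - N_itv a b V r1 r2 theta1 |
        <= (4 * n)%N%:R%:E)%E)
  /\
  (forall theta1 theta2 : R,
     (0 < theta1 /\ theta1 < theta2 /\ theta2 < pi) \/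
     (pi < theta1 /\ theta1 < theta2 /\ theta2 < 2 * pi) ->
     (`| N_lt a b V r theta2 - N_lt a b V r theta1 | <= n%:R%:E)%E /\
     (`| N_itv a b V r1 r2 theta2 - N_itv a b V r1 r2 theta1 |
        <= (2 * n)%N%:R%:E)%E).
Proof.
have close t1 t2 :
    (`| N_lt a b V r t2 - N_lt a b V r t1 | <= n%:R%:E)%E /\
    (`| N_itv a b V r1 r2 t2 - N_itv a b V r1 r2 t1 | <= (2 * n)%N%:R%:E)%E.
  have [H1 _] := counting_functions_close hab hV hVsym t1 t2 (lexx r).
  by have [_ H2] := counting_functions_close hab hV hVsym t1 t2 (ltW hr).
split=> t1 t2 *; last exact: close.
have [H1 H2] := close t1 t2; split.
  by apply: le_trans H1 _; rewrite lee_fin ler_nat leq_pmull.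
by apply: le_trans H2 _; rewrite lee_fin ler_nat leq_mul2r orbT.
Qed.
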